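(* There is an algorithm that, given a finitely generated subgroup $H\le F_n$, an element $g\in F_n$ and an integer $d\ge1$, tells us whether $\mathfrak I_g$ contains non-trivial equations of degree $d$, and, if so, produces an equation $w\in\mathfrak I_g$ of degree $d$.
   Context: $F_n$ is the free group with basis $a_1,\dots,a_n$. For a finitely generated subgroup $H\le F_n$ let $\langle x\rangle\cong\mathbb Z$ be infinite cyclic. An equation with coefficients in $H$ is an element $w\in H*\langle x\rangle$; it has a unique expression as a reduced word in the alphabet $\{x,x^{-1}\}\cup (H\setminus\{1\})$. The degree of $w$ is the number of occurrences of $x$ and $x^{-1}$ in the cyclic reduction of $w$. For $g\in F_n$ let $\varphi_g:H*\langle x\rangle\to F_n$ be the homomorphism that is the inclusion on $H$ and sends $x$ to $g$, and let $\mathfrak I_g=\ker\varphi_g$, a normal subgroup of $H*\langle x\rangle$. When an algorithm takes a finitely generated subgroup $H\le F_n$ as input, $H$ is given by a finite set of generators, each given as a word in the basis $a_1,\dots,a_n$. *)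

(* Defs.v *)
From HB Require Import structures.
From mathcomp Require Import all_boot.
From mathcomp Require Import boolp.

Set Implicit Arguments.
Unset Strict Implicit.
Unset Printing Implicit Defensive.

Local Open Scope group_scope.

(* A letter (a, false) is the basis element a and (a, true) is its inverse. *)
Definition word (A : Type) := seq (A * bool).

Section FreeGroup.
Variable A : choiceType.
Implicit Types (l : A * bool) (s t u : word A).

Definition invl l := (l.1, ~~ l.2).
Definition fcompat l l' := l' != invl l.
Definition freduced s := sorted fcompat s.

Definition fpush l s :=
  if s is l' :: t then if l' == invl l then t else l :: s else [:: l].
Definition freduce s : word A := foldr fpush [::] s.
Definition fact s t := foldr fpush t s.
Definition finv s := rev (map invl s).

Lemma invlK : involutive invl.
Proof. by case=> a b; rewrite /invl /= negbK. Qed.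

Lemma fpush_reduced l s : freduced s -> freduced (fpush l s).
Proof.
case: s => [//|l' s] /=; case: eqP => [_ /path_sorted //|/eqP ne red].
by rewrite /freduced /= /fcompat ne.
Qed.

Lemma fact_reduced s t : freduced t -> freduced (fact s t).
Proof. by move=> redt; elim: s => //= l s /(fpush_reduced l). Qed.

Lemma fpushK l s : freduced s -> fpush (invl l) (fpush l s) = s.
Proof.
case: s => [|l' s] /=; first by rewrite invlK eqxx.
case: eqP => [-> | _ _]; last by rewrite /= invlK eqxx.
by case: s => [|l2 s] //= /andP[/negPf-> _].
Qed.

Lemma fact_push l s u : freduced s -> freduced u ->
  fact (fpush l s) u = fpush l (fact s u).
Proof.
case: s => [|l' s] //= reds redu; case: eqP => // ->.
by have /= := fpushK (invl l) (fact_reduced s redu); rewrite invlK.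
Qed.

Lemma fact_assoc s t u : freduced t -> freduced u ->
  fact (fact s t) u = fact s (fact t u).
Proof.
move=> redt redu; elim: s => //= l s IH.
by rewrite fact_push ?IH //; apply: fact_reduced.
Qed.

Lemma freduce_id s : freduced s -> freduce s = s.
Proof.
elim: s => //= l s IH red; rewrite IH; last exact: path_sorted red.
by case: s red {IH} => //= l' s /andP[/negPf-> _].
Qed.

Lemma finvK : involutive finv.
Proof. by move=> s; rewrite /finv map_rev revK -map_comp map_id_in // => l _; apply: invlK. Qed.

Lemma finv_reduced s : freduced s -> freduced (finv s).
Proof.
rewrite /freduced /finv rev_sorted sorted_map => red.
apply: sub_sorted red => l l' ll'.
by rewrite /relpre /= /fcompat invlK eq_sym.
Qed.

Lemma factK s u : freduced u -> fact (finv s) (fact s u) = u.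
Proof.
move=> redu; elim: s => //= l s IH.
by rewrite /finv /= rev_cons -cats1 /fact foldr_cat /= fpushK ?fact_reduced.
Qed.

Record freegroup := FreeGroup { fval :> word A; _ : freduced fval }.

HB.instance Definition _ := [isSub for fval].
HB.instance Definition _ := [Choice of freegroup by <:].

Implicit Types x y z : freegroup.

Lemma fvalP x : freduced x. Proof. exact: valP. Qed.

Lemma freduce_reduced s : freduced (freduce s).
Proof. exact: fact_reduced. Qed.

Definition felt s : freegroup := FreeGroup (freduce_reduced s).
Definition fmul x y := FreeGroup (fact_reduced x (fvalP y)).
Definition finvg x := FreeGroup (finv_reduced (fvalP x)).
Definition fone : freegroup := @FreeGroup [::] isT.

Lemma fmulA : associative fmul.
Proof. by move=> x y z; apply: val_inj; rewrite /= fact_assoc ?fvalP. Qed.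
Lemma fmul1 : left_id fone fmul.
Proof. by move=> x; apply: val_inj. Qed.
Lemma fmulr1 : right_id fone fmul.
Proof. by move=> x; apply: val_inj; apply: freduce_id; apply: fvalP. Qed.
Lemma fmulV : left_inverse fone finvg fmul.
Proof.
move=> x; apply: val_inj => /=.
by rewrite -{2}[fval x](freduce_id (fvalP x)) [RHS]/= -[RHS](@factK x [::]).
Qed.
Lemma fmulrV : right_inverse fone finvg fmul.
Proof.
move=> x; rewrite -{1}(_ : finvg (finvg x) = x) ?fmulV //.
by apply: val_inj; apply: finvK.
Qed.

HB.instance Definition _ :=
  isGroup.Build freegroup fmulA fmul1 fmulr1 fmulV fmulrV.

End FreeGroup.

Arguments felt {A} s.

Section Subgroups.
Variable G : groupType.

(* The subgroup generated by S, as the intersection of the subgroups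
   containing S. *)
Definition gen (S : seq G) : {pred G} := fun x =>
  `[< forall P : {pred G}, group_closed P -> {subset S <= P} -> x \in P >].

Lemma genP (S : seq G) x : reflect
  (forall P : {pred G}, group_closed P -> {subset S <= P} -> x \in P)
  (x \in gen S).
Proof. exact: asboolP. Qed.

Lemma gen_subset (S : seq G) : {subset S <= gen S}.
Proof. by move=> x Sx; apply/genP => P _; apply. Qed.

Lemma gen_group_closed (S : seq G) : group_closed (gen S).
Proof.
split=> [|x y /genP Hx /genP Hy]; apply/genP => P clP SP.
  by case: clP.
by case: (clP) => _; apply; [apply: Hx | apply: Hy].
Qed.

Definition gen_group (S : seq G) : groupClosed G := HB.pack_for (groupClosed G) (gen S)
  (isInvClosed.Build G (gen S) (group_closedV (gen_group_closed S)))
  (isMul1Closed.Build G (gen S) (proj1 (gen_group_closed S)))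
  (isMulClosed.Build G (gen S) (group_closedM (gen_group_closed S))).

Record subgroup (H : groupClosed G) :=
  Subgroup { sgval : G; _ : sgval \in H }.

Section Instances.
Variable H : groupClosed G.

HB.instance Definition _ := [isSub for @sgval H].
HB.instance Definition _ := [Choice of subgroup H by <:].

Lemma subgroup_closed : group_closed [in H].
Proof.
split; first exact: gpred1.
by move=> x y Hx Hy; apply: gpredM => //; rewrite gpredVr.
Qed.

HB.instance Definition _ :=
  SubChoice_isSubGroup.Build G [in H] (subgroup H) subgroup_closed.
End Instances.
End Subgroups.

Section FreeProduct.
Variable G : groupType.

(* The alphabet {x, x^-1} U G: inl false is x, inl true is x^-1. *)
Definition letter := (bool + G)%type.
Implicit Types (a b : letter) (s t u : seq letter).

Definition is_var a := if a is inl _ then true else false.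
Definition nontriv a := if a is inr h then h != 1 else true.
Definition compat a b :=
  match a, b with
  | inl e, inl e' => e == e'
  | inr _, inr _ => false
  | _, _ => true
  end.
Definition reduced s := all nontriv s && sorted compat s.

Definition push a s :=
  match a, s with
  | inl e, inl e' :: t => if e == e' then a :: s else t
  | inl _, _ => a :: s
  | inr h, inr k :: t => if h * k == 1 then t else inr (h * k) :: t
  | inr h, _ => if h == 1 then s else a :: s
  end.
Definition act s t := foldr push t s.
Definition linv a : letter := match a with inl e => inl (~~ e) | inr h => inr h^-1 end.
Definition winv s := rev (map linv s).

Lemma reduced_cons a s : reduced (a :: s) ->
  [/\ nontriv a, reduced s & push a s = a :: s].
Proof.
case/andP=> /= /andP[na ns] pth; split=> //.
  by rewrite /reduced ns (path_sorted pth).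
case: a s na pth {ns} => [e|h] [|[e'|k] s] //=.
- by move=> _ /andP[/eqP-> _]; rewrite /push eqxx.
- by move=> /negPf nh _; rewrite /push nh.
- by move=> /negPf nh _; rewrite /push nh.
Qed.

Lemma push_reduced a s : reduced s -> reduced (push a s).
Proof.
case: s => [|b s]; first by case: a => //= h _; case: eqP => //= /eqP nh; rewrite /reduced /= nh.
move=> red; have [nb reds _] := reduced_cons red.
case: a b red nb => [e|h] [e'|k] red nb /=.
- by case: eqP => // ->; move: red; rewrite /reduced /= eqxx.
- by [].
- by case: eqP => // /eqP nh; move: red; rewrite /reduced /= nh.
- case: eqP => // /eqP nh; move: red; rewrite /reduced /= nh /=.
  by case/andP=> /andP[_ ->]; case: s {reds}.
Qed.

Lemma act_reduced s t : reduced t -> reduced (act s t).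
Proof. by move=> redt; elim: s => //= a s /(push_reduced a). Qed.

Lemma push1 s : push (inr 1) s = s \/ ~~ reduced s.
Proof.
case: s => [|[e|k] s] /=; rewrite ?eqxx; [by left | by left|].
rewrite mul1g; case: eqP => [->|_]; last by left.
by right; rewrite /reduced /= eqxx.
Qed.

Lemma pushM h k s : reduced s ->
  push (inr h) (push (inr k) s) = push (inr (h * k)) s.
Proof.
have base t : (if t is inr _ :: _ then false else true) ->
    push (inr h) (push (inr k) t) = push (inr (h * k)) t.
  case: t => [|[e|//] t] _ /=.
  - by case: (eqVneq k 1) => [->|_]; rewrite ?mulg1 //=.
  - by case: (eqVneq k 1) => [->|_]; rewrite ?mulg1 //=.
case: s => [|[e|m] s] red; [exact: base | exact: base |].
have [/= nm _ _] := reduced_cons red.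
have ns : if s is inr _ :: _ then false else true.
  by case: s red => [|[e|l] s] //; rewrite /reduced /= andbF.
rewrite /=; case: (eqVneq (k * m) 1) => [km|nkm] /=.
  rewrite -mulgA km mulg1; case: s ns {red} => [|[e|//] s] _ /=;
  by case: (eqVneq h 1) => // _.
by rewrite mulgA.
Qed.

Lemma pushK a s : reduced s -> push (linv a) (push a s) = s.
Proof.
case: a => [e|h] red.
  by case: e s red => [] [|[[]|k] [|[[]|k2] s]] //=; rewrite /reduced /= andbF.
rewrite [linv _]/= pushM // mulVg.
by case: (push1 s) => //; rewrite red.
Qed.

Lemma linvK : involutive linv.
Proof. by case=> [e|h] /=; rewrite ?negbK ?invgK. Qed.

Lemma act_push a s u : reduced s -> reduced u ->
  act (push a s) u = push a (act s u).
Proof.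
move=> reds redu; have redsu := act_reduced s redu.
case: a s reds redsu => [e|h] [|[e'|k] s] reds redsu //; rewrite [push _ _]/=.
- case: eqP => // ne.
  have <- : linv (inl e') = inl e :> letter by case: e e' ne {reds redsu} => [] [].
  by rewrite [act (_ :: _) u]/act [foldr _ _ _]/= pushK // act_reduced.
- by case: eqP => [->|//]; case: (push1 u) => [->|]; rewrite ?redu.
- case: eqP => [->|//].
  by case: (push1 (act (inl e' :: s) u)) => [->|] //; rewrite redsu.
- have -> : act (inr k :: s) u = push (inr k) (act s u) by [].
  rewrite pushM ?act_reduced //; case: eqP => [->|//].
  by case: (push1 (act s u)) => [->|] //; rewrite act_reduced.
Qed.

Lemma act_assoc s t u : reduced t -> reduced u ->
  act (act s t) u = act s (act t u).
Proof.
move=> redt redu; elim: s => //= a s IH.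
by rewrite act_push ?IH ?act_reduced.
Qed.

Lemma act_nil s : reduced s -> act s [::] = s.
Proof. by elim: s => //= a s IH /reduced_cons[_ /IH-> ->]. Qed.

Lemma winvK : involutive winv.
Proof. by move=> s; rewrite /winv map_rev revK -map_comp map_id_in // => a _; apply: linvK. Qed.

Lemma winv_reduced s : reduced s -> reduced (winv s).
Proof.
rewrite /reduced /winv all_rev all_map rev_sorted sorted_map => /andP[ns srt].
apply/andP; split.
  by apply: sub_all ns => -[e|h] //=; rewrite invg_eq1.
by apply: sub_sorted srt => -[e|h] [e'|k] //= /eqP->.
Qed.

Lemma actK s u : reduced u -> act (winv s) (act s u) = u.
Proof.
move=> redu; elim: s => //= a s IH.
by rewrite /winv /= rev_cons -cats1 /act foldr_cat /= pushK ?act_reduced.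
Qed.

(* The free product G * <x>, by normal forms. *)
Record freeprod := FreeProd { pval :> seq letter; _ : reduced pval }.

HB.instance Definition _ := [isSub for pval].
HB.instance Definition _ := [Choice of freeprod by <:].

Implicit Types w v z : freeprod.

Lemma pvalP w : reduced w. Proof. exact: valP. Qed.

Definition pmul w v := FreeProd (act_reduced w (pvalP v)).
Definition pinv w := FreeProd (winv_reduced (pvalP w)).
Definition pone := @FreeProd [::] isT.

Lemma pmulA : associative pmul.
Proof. by move=> w v z; apply: val_inj; rewrite /= act_assoc ?pvalP. Qed.
Lemma pmul1 : left_id pone pmul.
Proof. by move=> w; apply: val_inj. Qed.
Lemma pmulr1 : right_id pone pmul.
Proof. by move=> w; apply: val_inj; apply: act_nil; apply: pvalP. Qed.
Lemma pmulV : left_inverse pone pinv pmul.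
Proof.
move=> w; apply: val_inj => /=.
by rewrite -{2}[pval w](act_nil (pvalP w)) actK.
Qed.
Lemma pmulrV : right_inverse pone pinv pmul.
Proof.
move=> w; rewrite -{1}(_ : pinv (pinv w) = w) ?pmulV //.
by apply: val_inj; apply: winvK.
Qed.

HB.instance Definition _ :=
  isGroup.Build freeprod pmulA pmul1 pmulr1 pmulV pmulrV.

(* The cyclic reduction of a reduced word.  An x-letter and its inverse at the
   two ends cancel; two elements of G at the two ends are multiplied, in the
   cyclic order, and the product is either dropped or kept as the last letter.
   In the latter case the first letter of the result is an x-letter. *)
Fixpoint cycred_rec (k : nat) s : seq letter :=
  if k isn't k'.+1 then s else
  if s isn't a :: b :: t then s else
  let m := belast b t in
  match a, last b t with
  | inl e, inl e' => if e == e' then s else cycred_rec k' m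
  | inr h, inr h' =>
      if h' * h == 1 then cycred_rec k' m else rcons m (inr (h' * h))
  | _, _ => s
  end.
Definition cyclic_reduction w := cycred_rec (size w) w.

Definition degree w : nat := count is_var (cyclic_reduction w).

Section Evaluation.
Variables (K : groupType) (f : UMagmaMorphism.type G K) (g : K).

Definition letter_eval a : K :=
  match a with inl e => if e then g^-1 else g | inr h => f h end.
Definition eval w : K := \prod_(a <- pval w) letter_eval a.

Lemma eval_push a s : \prod_(b <- push a s) letter_eval b =
  letter_eval a * \prod_(b <- s) letter_eval b.
Proof.
case: a s => [e|h] [|[e'|k] s] /=; rewrite ?big_cons //.
- case: eqP => [->|ne]; rewrite ?big_cons //= mulgA.
  by case: e e' ne => [] [] // _; rewrite ?mulVg ?mulgV mul1g.
- by case: eqP => [->|_]; rewrite ?big_cons // gmulf1 mul1g.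
- by case: eqP => [->|_]; rewrite ?big_cons // gmulf1 mul1g.
- case: eqP => [hk|_]; rewrite ?big_cons /= mulgA -gmulfM // hk gmulf1 mul1g //.
Qed.

Lemma eval_mul : {morph eval : w v / w * v}.
Proof.
move=> w v; rewrite /eval /=; elim: (pval w) => [|a s IH] /=.
  by rewrite big_nil mul1g.
by rewrite eval_push IH big_cons mulgA.
Qed.

Lemma eval1 : eval 1 = 1. Proof. by rewrite /eval big_nil. Qed.

HB.instance Definition _ := isUMagmaMorphism.Build freeprod K eval (eval1, eval_mul).
End Evaluation.
End FreeProduct.

Definition equation (G : groupType) (H : groupClosed G) :=
  freeprod (subgroup H).

Section Ideal.
Variables (G : groupType) (H : groupClosed G).

Definition phi (g : G) : equation H -> G :=
  @eval (subgroup H) G (val : subgroup H -> G) g.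

HB.instance Definition _ (g : G) := UMagmaMorphism.copy (phi g)
  (@eval (subgroup H) G (val : subgroup H -> G) g).

Definition ideal (g : G) : {pred equation H} := fun w => phi g w == 1.
End Ideal.

Arguments phi {G} H g w.
Arguments ideal {G} H g.

(* Partial recursive functions.  A program reads a list of arguments; missing
   arguments of Succ and Proj are read as 0. *)
Inductive recfun : Type :=
| Zero
| Succ
| Proj of nat
| Comp of recfun & seq recfun
| PrimRec of recfun & recfun
| Mu of recfun.

Local Open Scope nat_scope.

Inductive computes : recfun -> seq nat -> nat -> Prop :=
| computes_Zero v : computes Zero v 0
| computes_Succ v : computes Succ v (nth 0 v 0).+1
| computes_Proj i v : computes (Proj i) v (nth 0 v i)
| computes_Comp f fs v ys y :
    computes_seq fs v ys -> computes f ys y -> computes (Comp f fs) v y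
| computes_PrimRec0 f g v y :
    computes f v y -> computes (PrimRec f g) (0 :: v) y
| computes_PrimRecS f g v m z y :
    computes (PrimRec f g) (m :: v) z -> computes g (m :: z :: v) y ->
    computes (PrimRec f g) (m.+1 :: v) y
| computes_Mu f v m (k : nat -> nat) :
    (forall i, i < m -> computes f (i :: v) (k i).+1) ->
    computes f (m :: v) 0 -> computes (Mu f) v m
with computes_seq : seq recfun -> seq nat -> seq nat -> Prop :=
| computes_nil v : computes_seq [::] v [::]
| computes_cons f fs v y ys :
    computes f v y -> computes_seq fs v ys ->
    computes_seq (f :: fs) v (y :: ys).

Scheme computes_mind := Induction for computes Sort Prop
with computes_seq_mind := Induction for computes_seq Sort Prop.

Lemma computes_functional p v y y' :
  computes p v y -> computes p v y' -> y = y'.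
Proof.
move=> c; move: p v y c y'.
refine (computes_mind (P := fun p v y _ => forall y', computes p v y' -> y = y')
  (P0 := fun ps v ys _ => forall ys', computes_seq ps v ys' -> ys = ys')
  _ _ _ _ _ _ _ _ _).
- by move=> v y' c; inversion c.
- by move=> v y' c; inversion c.
- by move=> i v y' c; inversion c.
- move=> f fs v ys y _ IHs _ IH y' c; inversion c as [| | |? ? ? ys' ? cs cf| | |].
  by apply: IH; rewrite (IHs _ cs).
- by move=> f g v y _ IH y' c; inversion c; apply: IH.
- move=> f g v m z y _ IHz _ IH y' c; inversion c as [| | | | |? ? ? ? z' ? cz cg|].
  by apply: IH; rewrite (IHz _ cz).
- move=> f v m k _ IHk _ IH0 y' c; inversion c as [| | | | | |? ? ? k' ck' c0].
  have [lt_y'm|lt_my'|//] := ltngtP m y'.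
    by have := IH0 _ (ck' _ lt_y'm).
  by have := IHk _ lt_my' _ c0.
- by move=> v ys' c; inversion c.
- move=> f fs v y ys _ IHf _ IHs ys' c; inversion c as [|? ? ? y' ys2 cy cys].
  by rewrite (IHf _ cy) (IHs _ cys).
Qed.

Section Codes.
Variable n : nat.

Definition code_word (s : word 'I_n) : nat :=
  CodeSeq.code [seq (nat_of_ord l.1).*2 + nat_of_bool l.2 | l : 'I_n * bool <- s].

Definition code_words (ss : seq (word 'I_n)) : nat :=
  CodeSeq.code (map code_word ss).

Variable H : groupClosed (freegroup 'I_n).

Definition code_letter (a : letter (subgroup H)) : nat :=
  match a with
  | inl e => e
  | inr h => (code_word (val (val h))).+2
  end.

Definition code_equation (w : equation H) : nat :=
  CodeSeq.code (map code_letter w).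
End Codes.

(* Main.v *)
Require Import Defs.
From mathcomp Require Import all_boot.
From mathcomp Require Import zify boolp.
Import Defs.

(** Membership in the ideal, for a fixed pattern of signs, asks for elements of
    H, nontrivial where two inverse letters meet, that fill the slots of a
    product of constants g, g^-1 and multiply to 1.  A reduced element of H is
    read letter by letter; by [gen_prefix] the prefixes lie in finitely many
    cosets H s^-1, so such products are the labels of the runs of a finite
    automaton whose edges carry group elements of bounded length.  If a run has
    a short product, then by tree geometry ([flen_peak]) two consecutive edges
    at a peak of the walk compose to a short element; hence its product is
    obtained from edges by composing only short elements, in a number of rounds
    bounded by the number of triples (state, short element, state).  This yields
    an explicit bound on a smallest solution, and the algorithm searches up to
    this bound. *)

Set Implicit Arguments.
Unset Strict Implicit.
Unset Printing Implicit Defensive.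

(** * Computable functions on encoded data *)

Class Enc (T : Type) := en : T -> nat.
#[local] Instance enc_nat : Enc nat := id.
#[local] Instance enc_bool : Enc bool := nat_of_bool.
#[local] Instance enc_seq (T : Type) (e : Enc T) : Enc (seq T) :=
  fun s => CodeSeq.code (map en s).

Class Ctx (C : Type) := {
  lst : C -> seq nat;
  arity : nat;
  size_lst : forall c, size (lst c) = arity }.
(* A context is the list of the encoded variables, the most recent one first, as
   in the calls made by PrimRec. *)
#[local, refine] Instance ctx_unit : Ctx unit := {| lst _ := [::]; arity := 0 |}.
Proof. by []. Defined.
#[local, refine] Instance ctx_prod (C T : Type) (c : Ctx C) (e : Enc T) : Ctx (C * T) :=
  {| lst x := en x.2 :: lst x.1; arity := (arity (C := C)).+1 |}.
Proof. by move=> x /=; rewrite size_lst. Defined.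

Definition computable (C T : Type) (c : Ctx C) (e : Enc T) (f : C -> T) :=
  exists P, forall x, computes P (lst x) (en (f x)).
Arguments computable {C T c e} f.

Section Rules.
Context {C : Type} {ctxC : Ctx C}.

Lemma computes_projs (v : seq nat) (s : seq nat) :
  computes_seq (map Proj s) v (map (nth 0 v) s).
Proof. by elim: s => [|i s IH]; constructor => //; constructor. Qed.

(** These projections skip freshly pushed arguments p, so that a program for the old context can be
    called in a larger one. *)
Lemma computes_wk (p : seq nat) (x : C) :
  computes_seq (map Proj (iota (size p) (arity (C := C)))) (p ++ lst x) (lst x).
Proof.
have H (s : seq nat) : map (nth 0 (p ++ s)) (iota (size p) (size s)) = s.
  rewrite -[size p]addn0 iotaDl -map_comp -[RHS](mkseq_nth 0).
  by apply: eq_map => k; rewrite /= nth_cat addKn ltnNge leq_addr.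
by rewrite -[X in computes_seq _ _ X]H size_lst; exact: computes_projs.
Qed.

Lemma computable_ext T (e : Enc T) (f g : C -> T) : f =1 g -> computable f -> computable g.
Proof. by move=> fg [P HP]; exists P => x; rewrite -fg. Qed.

Lemma computable_wk T A (e : Enc T) (a : Enc A) (f : C -> T) :
  computable f -> computable (fun x : C * A => f x.1).
Proof.
move=> [P HP]; exists (Comp P (map Proj (iota 1 (arity (C := C))))) => x.
by econstructor; [exact: (computes_wk [:: _]) | exact: HP].
Qed.

Lemma computable_var0 T (e : Enc T) : computable (fun x : C * T => x.2).
Proof. by exists (Proj 0) => x; constructor. Qed.

Lemma computable_sub T A (e : Enc T) (a : Enc A) (f : C -> A -> T) (g : C -> A) :
  computable (fun x : C * A => f x.1 x.2) -> computable g -> computable (fun x => f x (g x)).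
Proof.
move=> [P HP] [Q HQ]; exists (Comp P (Q :: map Proj (iota 0 (arity (C := C))))) => x.
econstructor; last exact: (HP (x, g x)).
by constructor => //; exact: (computes_wk [::]).
Qed.

(** Here f is computed over the context of its own argument alone, so that one hint about f serves
    in every context. *)
Lemma computable_app1 A B (a : Enc A) (b : Enc B) (f : A -> B) (x : C -> A) :
  computable (fun c : unit * A => f c.2) -> computable x -> computable (fun c => f (x c)).
Proof.
move=> [P HP] [X HX]; exists (Comp P [:: X]) => c.
by econstructor; last exact: (HP (tt, x c)); repeat constructor.
Qed.

Lemma computable_app2 A1 A2 B (a1 : Enc A1) (a2 : Enc A2) (b : Enc B) (f : A1 -> A2 -> B)
    (x : C -> A1) (y : C -> A2) :
  computable (fun c : unit * A1 * A2 => f c.1.2 c.2) -> computable x -> computable y ->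
  computable (fun c => f (x c) (y c)).
Proof.
move=> [P HP] [X HX] [Y HY]; exists (Comp P [:: Y; X]) => c.
by econstructor; last exact: (HP (tt, x c, y c)); repeat constructor.
Qed.

Lemma computable_app3 A1 A2 A3 B (a1 : Enc A1) (a2 : Enc A2) (a3 : Enc A3) (b : Enc B)
    (f : A1 -> A2 -> A3 -> B) (x : C -> A1) (y : C -> A2) (z : C -> A3) :
  computable (fun c : unit * A1 * A2 * A3 => f c.1.1.2 c.1.2 c.2) ->
  computable x -> computable y -> computable z -> computable (fun c => f (x c) (y c) (z c)).
Proof.
move=> [P HP] [X HX] [Y HY] [Z HZ]; exists (Comp P [:: Z; Y; X]) => c.
by econstructor; last exact: (HP (tt, x c, y c, z c)); repeat constructor.
Qed.

Lemma computable_S (f : C -> nat) : computable f -> computable (fun x => (f x).+1).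
Proof.
move=> [P HP]; exists (Comp Succ [:: P]) => x.
by econstructor; [repeat constructor; exact: HP | exact: (computes_Succ [:: _])].
Qed.

Lemma computable_nat (n : nat) : computable (fun _ : C => n).
Proof. by elim: n => [|n /computable_S//]; exists Zero => x; constructor. Qed.

Lemma computable_const T (e : Enc T) (t : T) : computable (fun _ : C => t).
Proof. by have [P HP] := computable_nat (en t); exists P. Qed.

Lemma computable_en T (e : Enc T) (f : C -> T) : computable f -> computable (fun x => en (f x)).
Proof. by []. Qed.

(** [PrimRec] hands its step function the counter, then the previous value, then the parameters;
    hence the order C * A * nat of the context. *)
Lemma computable_iteri A (a : Enc A) (n : C -> nat) (f : C -> nat -> A -> A) (z : C -> A) :
  computable n -> computable (fun x : C * A * nat => f x.1.1 x.2 x.1.2) -> computable z ->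
  computable (fun x => iteri (n x) (f x) (z x)).
Proof.
move=> Hn [F HF] [Z HZ].
apply: (computable_sub (f := fun x m => iteri m (f x) (z x))) Hn.
exists (PrimRec Z F) => -[x m] /=; rewrite {1}[en]/en /enc_nat.
elim: m => [|m IH] /=; first by constructor.
by econstructor; [exact: IH | exact: (HF (x, _, m))].
Qed.

End Rules.

Section Loops.
Context {C : Type} {ctxC : Ctx C}.

Lemma computable_iter A (a : Enc A) (n : C -> nat) (f : C -> A -> A) (z : C -> A) :
  computable n -> computable (fun x : C * A => f x.1 x.2) -> computable z ->
  computable (fun x => iter (n x) (f x) (z x)).
Proof.
move=> Hn Hf Hz; have := computable_iteri (f := fun x _ => f x) Hn (computable_wk _ Hf) Hz.
by apply: computable_ext => x; elim: (n x) => //= m ->.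
Qed.

(** A conditional is a loop that runs once or never: it starts at g x and its body is constantly f
    x. *)
Lemma computable_if A (a : Enc A) (b : C -> bool) (f g : C -> A) :
  computable b -> computable f -> computable g -> computable (fun x => if b x then f x else g x).
Proof.
move=> [B HB] Hf Hg.
have Hb : computable (fun x => nat_of_bool (b x)) by exists B.
have := computable_iteri (f := fun x _ _ => f x) Hb (computable_wk _ (computable_wk _ Hf)) Hg.
by apply: computable_ext => x; case: (b x).
Qed.
End Loops.

Ltac cmp_var :=
  lazymatch goal with
  | |- computable snd => exact: computable_var0
  | |- computable (fun x => x.2) => exact: computable_var0
  | |- computable (fun x => x.1.2) => exact: (computable_wk _ (computable_var0 _))
  | |- computable (fun x => x.1.1.2) =>
      exact: (computable_wk _ (computable_wk _ (computable_var0 _)))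
  | |- computable (fun x => x.1.1.1.2) =>
      exact: (computable_wk _ (computable_wk _ (computable_wk _ (computable_var0 _))))
  end.
Create HintDb computabledb discriminated.
Ltac cmp_app :=
  match goal with
  | |- computable (fun x => ?f (@?a x) (@?b x) (@?c x)) =>
      apply: (@computable_app3 _ _ _ _ _ _ _ _ _ _ f a b c);
      [solve [auto with computabledb nocore] | | |]
  | |- computable (fun x => ?f (@?a x) (@?b x)) =>
      apply: (@computable_app2 _ _ _ _ _ _ _ _ f a b);
      [solve [auto with computabledb nocore] | |]
  | |- computable (fun x => ?f (@?a x)) =>
      apply: (@computable_app1 _ _ _ _ _ _ f a);
      [solve [auto with computabledb nocore] |]
  end.
Ltac cmp_step :=
  lazymatch goal with
  | |- computable snd => cmp_var
  | |- computable (fun x => S _) => apply: computable_S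
  | |- computable (fun x => if _ then _ else _) => apply: computable_if
  | |- computable (fun x => iter _ _ _) => apply: computable_iter
  | |- computable (fun x => iteri _ _ _) => apply: computable_iteri
  | |- _ => first [cmp_var | cmp_app | apply: computable_const]
  end.
Ltac cmp_auto := repeat (cmp_step; cbv beta; cbn [fst snd]).

(** * Arithmetic and Boolean operations *)

Lemma computable_add : computable (fun c : unit * nat * nat => c.1.2 + c.2).
Proof.
apply: (@computable_ext _ _ _ _
  (fun c : unit * nat * nat => iter c.1.2 S c.2));
  last by cmp_auto.
by move=> c; rewrite iter_succn addnC.
Qed.
#[local] Hint Resolve computable_add : computabledb.

Lemma computable_pred : computable (fun c : unit * nat => c.2.-1).
Proof.
apply: (@computable_ext _ _ _ _
  (fun c : unit * nat => iteri c.2 (fun m _ => m) 0));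
  last by cmp_auto.
by case=> ? [].
Qed.
#[local] Hint Resolve computable_pred : computabledb.

Lemma computable_sub_nat : computable (fun c : unit * nat * nat => c.1.2 - c.2).
Proof.
apply: (@computable_ext _ _ _ _
  (fun c : unit * nat * nat => iter c.2 predn c.1.2));
  last by cmp_auto.
by move=> c; rewrite iter_predn.
Qed.
#[local] Hint Resolve computable_sub_nat : computabledb.

Lemma computable_mul : computable (fun c : unit * nat * nat => c.1.2 * c.2).
Proof.
apply: (@computable_ext _ _ _ _
  (fun c : unit * nat * nat => iter c.1.2 (addn c.2) 0));
  last by cmp_auto.
by move=> c; rewrite iter_addn_0 mulnC.
Qed.
#[local] Hint Resolve computable_mul : computabledb.

Lemma computable_exp : computable (fun c : unit * nat * nat => c.1.2 ^ c.2).
Proof.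
apply: (@computable_ext _ _ _ _
  (fun c : unit * nat * nat => iter c.2 (muln c.1.2) 1));
  last by cmp_auto.
by move=> c; rewrite iter_muln_1.
Qed.
#[local] Hint Resolve computable_exp : computabledb.

Lemma computable_negb : computable (fun c : unit * bool => ~~ c.2).
Proof.
apply: (@computable_ext _ _ _ _
  (fun c : unit * bool => if c.2 then false else true));
  last by cmp_auto.
by case=> ? [].
Qed.
#[local] Hint Resolve computable_negb : computabledb.

Lemma computable_andb : computable (fun c : unit * bool * bool => c.1.2 && c.2).
Proof. by rewrite /andb; cmp_auto. Qed.
Lemma computable_orb : computable (fun c : unit * bool * bool => c.1.2 || c.2).
Proof. by rewrite /orb; cmp_auto. Qed.
#[local] Hint Resolve computable_andb computable_orb : computabledb.

Lemma computable_eq0 : computable (fun c : unit * nat => c.2 == 0).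
Proof.
apply: (@computable_ext _ _ _ _
  (fun c : unit * nat => iter c.2 (fun=> false) true));
  last by cmp_auto.
by case=> ? [].
Qed.

Lemma computable_leq : computable (fun c : unit * nat * nat => c.1.2 <= c.2).
Proof.
by rewrite /leq; apply: (computable_app1 (f := fun k => k == 0) computable_eq0); cmp_auto.
Qed.
#[local] Hint Resolve computable_leq : computabledb.

Lemma computable_eqn : computable (fun c : unit * nat * nat => c.1.2 == c.2).
Proof.
apply: (@computable_ext _ _ _ _
  (fun c : unit * nat * nat => (c.1.2 <= c.2) && (c.2 <= c.1.2)));
  last by cmp_auto.
by move=> c; rewrite eqn_leq.
Qed.
#[local] Hint Resolve computable_eqn : computabledb.

Lemma computable_odd : computable (fun c : unit * nat => odd c.2).
Proof.
apply: (@computable_ext _ _ _ _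
  (fun c : unit * nat => iter c.2 negb false));
  last by cmp_auto.
by case=> ?; elim=> //= m ->.
Qed.
#[local] Hint Resolve computable_odd : computabledb.

(** The half, rounded down, is the number of odd numbers below the argument. *)
Lemma computable_half : computable (fun c : unit * nat => c.2./2).
Proof.
apply: (@computable_ext _ _ _ _
  (fun c : unit * nat => iteri c.2 (fun m h => if odd m then h.+1 else h) 0));
  last by cmp_auto.
by case=> ?; elim=> //= m ->; rewrite uphalf_half; case: (odd m).
Qed.
#[local] Hint Resolve computable_half : computabledb.

Lemma computable_double : computable (fun c : unit * nat => c.2.*2).
Proof.
apply: (@computable_ext _ _ _ _
  (fun c : unit * nat => c.2 + c.2));
  last by cmp_auto.
by move=> c; rewrite addnn.
Qed.
#[local] Hint Resolve computable_double : computabledb.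

(** A list with head m and tail code r has code c = 2 ^ m * r.*2.+1. Stripping factors 2 leaves
    r.*2.+1, which yields the tail; the head is the number of rounds in which the iterate is still
    even. Since m <= c, c rounds suffice. *)
Definition strip1 x := if odd x then x else x./2.
Definition strip2 c := iter c strip1 c.
Definition code_tail c := (strip2 c)./2.
Definition code_head c :=
  iteri c (fun i h => if odd (iter i strip1 c) then h else h.+1) 0.

Lemma strip2E m r j : iter j strip1 (2 ^ m * r.*2.+1) =
  2 ^ (m - j) * r.*2.+1.
Proof.
elim: j => [|j IH]; first by rewrite subn0.
rewrite iterS IH; case: (leqP m j) => mj.
  have [-> ->] : m - j = 0 /\ m - j.+1 = 0 by lia.
  by rewrite !mul1n /strip1 /= odd_double.
have -> : m - j = (m - j.+1).+1 by lia.
by rewrite expnS -mulnA mul2n /strip1 odd_double doubleK.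
Qed.

Lemma leq_code_cons m r : m <= 2 ^ m * r.*2.+1.
Proof. by apply: leq_trans (ltnW (ltn_expl m (ltnSn 1))) _; rewrite leq_pmulr. Qed.

Lemma code_tailE m r : code_tail (2 ^ m * r.*2.+1) = r.
Proof.
rewrite /code_tail /strip2 strip2E (eqP (leq_code_cons m r)) mul1n.
by rewrite -addn1 halfD odd_double doubleK addn0.
Qed.

Lemma code_headE m r : code_head (2 ^ m * r.*2.+1) = m.
Proof.
rewrite /code_head; set c := _ * _.
have H j : iteri j (fun i h => if odd (iter i strip1 c) then h else h.+1) 0 =
    minn j m.
  elim: j => [|j IH]; first by rewrite min0n.
  rewrite iteriS {}IH strip2E oddM /= odd_double andbT.
  case: (leqP m j) => mj; first by rewrite (eqP mj) /=; lia.
  have -> : m - j = (m - j.+1).+1 by lia.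
  by rewrite expnS mul2n odd_double; lia.
by rewrite H; apply/minn_idPr; exact: leq_code_cons.
Qed.

Lemma computable_strip1 : computable (fun c : unit * nat => strip1 c.2).
Proof. by rewrite /strip1; cmp_auto. Qed.
#[local] Hint Resolve computable_strip1 : computabledb.

Lemma computable_code_tail : computable (fun c : unit * nat => code_tail c.2).
Proof. by rewrite /code_tail /strip2; cmp_auto. Qed.
Lemma computable_code_head : computable (fun c : unit * nat => code_head c.2).
Proof. by rewrite /code_head; cmp_auto. Qed.
#[local] Hint Resolve computable_code_tail computable_code_head : computabledb.

(** * Lists and folds *)

Section Lists.
Context {C T : Type} {ctxC : Ctx C} {e : Enc T}.

Lemma computable_cons (f : C -> T) (g : C -> seq T) :
  computable f -> computable g -> computable (fun x => f x :: g x).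
Proof.
move=> Hf Hg.
have : computable (fun x => 2 ^ (en (f x)) * (en (g x)).*2.+1) by cmp_auto.
by [].
Qed.

Lemma computable_behead (g : C -> seq T) : computable g -> computable (fun x => behead (g x)).
Proof.
move=> Hg; have [P HP] : computable (fun x => code_tail (en (g x))) by cmp_auto.
exists P => x; move: (HP x); rewrite /en /enc_nat /enc_seq.
by case: (g x) => //= a s; rewrite code_tailE.
Qed.

Lemma computable_nilp (g : C -> seq T) : computable g -> computable (fun x => nilp (g x)).
Proof.
move=> Hg; have H : computable (fun x => en (g x) <= 0) by cmp_auto.
apply: computable_ext H => x; rewrite /en /enc_seq; case: (g x) => //= a s.
by rewrite leqn0 muln_eq0 expn_eq0.
Qed.

Lemma computable_head (t0 : T) (g : C -> seq T) :
  computable g -> computable (fun x => head t0 (g x)).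
Proof.
move=> Hg.
have [P HP] : computable (fun x => if nilp (g x) then en t0 else code_head (en (g x))).
  by apply: computable_if; [exact: computable_nilp | exact: computable_const | cmp_auto].
exists P => x; move: (HP x); rewrite /en /enc_nat /enc_seq.
by case: (g x) => //= a s; rewrite code_headE.
Qed.

End Lists.

Class Inh (T : Type) := inh : T.
#[local] Instance inh_nat : Inh nat := 0.
#[local] Instance inh_seq (T : Type) : Inh (seq T) := [::].

(* The state of a left fold: the accumulator and the part that is still unread. *)
#[local] Instance enc_read (A T : Type) (a : Enc A) (e : Enc T) : Enc (A * seq T) :=
  fun p => CodeSeq.code (en p.1 :: map en p.2).

Section Fold.
Context {C A T : Type} {ctxC : Ctx C} {a : Enc A} {e : Enc T}.

Lemma computable_acc (g : C -> A * seq T) : computable g -> computable (fun x => (g x).1).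
Proof.
move=> Hg; have [P HP] : computable (fun x => code_head (en (g x))) by cmp_auto.
by exists P => x; move: (HP x); rewrite /en /enc_nat /enc_read /= code_headE.
Qed.

Lemma computable_rest (g : C -> A * seq T) : computable g -> computable (fun x => (g x).2).
Proof.
move=> Hg; have [P HP] : computable (fun x => code_tail (en (g x))) by cmp_auto.
by exists P => x; move: (HP x); rewrite /en /enc_nat /enc_read /= code_tailE.
Qed.

Lemma computable_pair (g : C -> A) (h : C -> seq T) :
  computable g -> computable h -> computable (fun x => (g x, h x)).
Proof.
move=> Hg Hh; have [P HP] : computable (fun x => 2 ^ (en (g x)) * (en (h x)).*2.+1) by cmp_auto.
by exists P.
Qed.
End Fold.

Section Foldl.
Context {C A T : Type} {ctxC : Ctx C} {a : Enc A} {e : Enc T} {i : Inh T}.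

(** The loop runs as often as the code of the list says, which is at least its length; [step] is the
    identity once the list is exhausted. *)
Lemma computable_foldl (f : C -> A -> T -> A) (z : C -> A) (l : C -> seq T) :
  computable (fun x : C * A * T => f x.1.1 x.1.2 x.2) -> computable z -> computable l ->
  computable (fun x => foldl (f x) (z x) (l x)).
Proof.
move=> [F HF] Hz Hl.
pose step x (p : A * seq T) :=
  if nilp p.2 then p else (f x p.1 (head i p.2), behead p.2).
have v2 : computable (fun x : C * (A * seq T) => x.2) by cmp_auto.
have Hf : computable (fun x : C * (A * seq T) => f x.1 x.2.1 (head i x.2.2)).
  have [X HX] := computable_acc v2.
  have [Y HY] := computable_head i (computable_rest v2).
  exists (Comp F (Y :: X :: map Proj (iota 1 (arity (C := C))))) => -[x p].
  econstructor; last exact: (HF (x, p.1, head i p.2)).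
  by constructor; [exact: HY | constructor; [exact: HX | exact: (computes_wk [:: _])]].
have Hstep : computable (fun x : C * (A * seq T) => step x.1 x.2).
  apply: computable_if; [exact: computable_nilp (computable_rest v2) | by [] |].
  by apply: computable_pair => //; exact: computable_behead (computable_rest v2).
have : computable (fun x => (iter (en (l x)) (step x) (z x, l x)).1).
  by apply/computable_acc/computable_iter => //; exact: computable_pair.
apply: computable_ext => x.
have : size (l x) <= en (l x).
  rewrite /en /enc_seq; elim: (l x) => //= t s IH.
  apply: leq_ltn_trans IH (leq_trans _ (leq_pmull _ _)); last by rewrite expn_gt0.
  by lia.
move: (en (l x)) => m.
elim: m (z x) (l x) => [|m IH] y [|t s] //= sm; rewrite -iterS iterSr ?IH //=.
Qed.

End Foldl.

Section Foldr.
Context {C A T : Type} {ctxC : Ctx C} {a : Enc A} {e : Enc T} {i : Inh T}.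

Lemma computable_rev (l : C -> seq T) : computable l -> computable (fun x => rev (l x)).
Proof.
move=> Hl; have : computable (fun x => foldl (fun s t => t :: s) [::] (l x)).
  by apply: computable_foldl => //; [apply: computable_cons; cmp_auto | exact: computable_const].
apply: computable_ext => x; rewrite /rev; elim: (l x) [::] => //= t s IH r.
Qed.

Lemma computable_foldr (f : C -> T -> A -> A) (z : C -> A) (l : C -> seq T) :
  computable (fun x : C * A * T => f x.1.1 x.2 x.1.2) -> computable z -> computable l ->
  computable (fun x => foldr (f x) (z x) (l x)).
Proof.
move=> Hf Hz /computable_rev Hl.
have := computable_foldl (i := i) (f := fun x a t => f x t a) Hf Hz Hl.
by apply: computable_ext => x; rewrite foldl_rev.
Qed.
End Foldr.

Section ListFunctions.
Context {C A T : Type} {ctxC : Ctx C} {a : Enc A} {e : Enc T} {i : Inh T}.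

Lemma computable_map (f : C -> T -> A) (l : C -> seq T) :
  computable (fun x : C * T => f x.1 x.2) -> computable l ->
  computable (fun x => map (f x) (l x)).
Proof.
move=> [F HF] Hl; have : computable (fun x => foldr (fun t s => f x t :: s) [::] (l x)).
  apply: computable_foldr => //; last exact: computable_const.
  apply: computable_cons;
  last by cmp_auto.
  (* Argument 1 is the accumulator, which f does not see, so the context of f resumes at argument
     2. *)
  exists (Comp F (Proj 0 :: map Proj (iota 2 (arity (C := C))))) => -[[x s] t].
  econstructor; last exact: (HF (x, t)).
  by constructor; [constructor | exact: (computes_wk [:: _; _])].
by apply: computable_ext => x; elim: (l x) => //= t s ->.
Qed.

Lemma computable_cat (f g : C -> seq T) :
  computable f -> computable g -> computable (fun x => f x ++ g x).
Proof.
move=> Hf Hg; have : computable (fun x => foldr cons (g x) (f x)).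
  by apply: computable_foldr => //; apply: computable_cons; cmp_auto.
by apply: computable_ext => x; elim: (f x) => //= t s ->.
Qed.

Lemma computable_drop (n : C -> nat) (g : C -> seq T) :
  computable n -> computable g -> computable (fun x => drop (n x) (g x)).
Proof.
move=> Hn Hg; have : computable (fun x => iter (n x) behead (g x)).
  by apply: computable_iter => //; apply: computable_behead; cmp_auto.
by apply: computable_ext => x; elim: (n x) (g x) => [|m IH] [|t s] //;
  rewrite iterSr /= IH // ?drop_oversize.
Qed.

Lemma computable_nth (t0 : T) (n : C -> nat) (g : C -> seq T) :
  computable n -> computable g -> computable (fun x => nth t0 (g x) (n x)).
Proof.
move=> Hn Hg; have := computable_head t0 (computable_drop Hn Hg).
by apply: computable_ext => x; rewrite -nth0 nth_drop addn0.
Qed.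

End ListFunctions.

Lemma computable_flatten (C T : Type) (ctxC : Ctx C) (e : Enc T) (i : Inh T)
    (g : C -> seq (seq T)) :
  computable g -> computable (fun x => flatten (g x)).
Proof.
by move=> Hg; apply: computable_foldr => //;
  [apply: computable_cat; cmp_auto | exact: computable_const].
Qed.

Ltac cmp_list :=
  lazymatch goal with
  | |- computable snd => cmp_var
  | |- computable (fun x => cons _ _) => apply: computable_cons
  | |- computable (fun x => head _ _) => apply: computable_head
  | |- computable (fun x => behead _) => apply: computable_behead
  | |- computable (fun x => nilp _) => apply: computable_nilp
  | |- computable (fun x => foldl _ _ _) => apply: computable_foldl
  | |- computable (fun x => foldr _ _ _) => apply: computable_foldr
  | |- computable (fun x => rev _) => apply: computable_rev
  | |- computable (fun x => map _ _) => apply: computable_map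
  | |- computable (fun x => cat _ _) => apply: computable_cat
  | |- computable (fun x => nth _ _ _) => apply: computable_nth
  | |- computable (fun x => flatten _) => apply: computable_flatten
  | |- _ => cmp_step
  end.
Ltac cmp_lauto := repeat (cmp_list; cbv beta; cbn [fst snd]).

(** * Lengths in free groups *)

Section CommonPrefix.
Variable T : eqType.
Implicit Types s t u p : seq T.

Fixpoint lcp s t :=
  match s, t with
  | x :: s', y :: t' => if x == y then (lcp s' t').+1 else 0
  | _, _ => 0
  end.

Lemma lcpC s t : lcp s t = lcp t s.
Proof. by elim: s t => [|x s IH] [|y t] //=; rewrite eq_sym; case: eqP => // _; rewrite IH. Qed.

(** In the Cayley tree [lcp] is the Gromov product based at 1; this is the 0-hyperbolicity of the
    tree. *)
Lemma lcp_ultrametric s t u : minn (lcp s t) (lcp t u) <= lcp s u.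
Proof.
elim: s t u => [|x s IH] [|y t] [|z u] //=; rewrite ?minn0 ?min0n //.
case: eqP => [->|_]; rewrite ?min0n //.
by case: eqP => _; rewrite ?minn0 // minnSS ltnS.
Qed.

Lemma lcp_size s t : lcp s t <= size s.
Proof. by elim: s t => [|x s IH] [|y t] //=; case: eqP => // _; exact: IH. Qed.

Lemma lcp_prefix p s : (lcp p s == size p) = prefix p s.
Proof. by elim: p s => [|x p IH] [|y s] //=; rewrite -IH; case: (x =P y). Qed.
End CommonPrefix.

Section Length.
Variable A : choiceType.
Local Notation F := (freegroup A).
Implicit Types (s t : word A) (x y z a b c p : F).

Definition flen x := size (fval x).

(** Reducing s^-1 t cancels exactly the longest common prefix, once on each side. *)
Lemma fact_size s t : freduced s -> freduced t ->
  size (fact (finv s) t) + (lcp s t).*2 = size s + size t.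
Proof.
have nocancel s' t' : freduced s' -> freduced t' -> lcp s' t' = 0 ->
    size (fact (finv s') t') = size s' + size t'.
  elim: s' t' => [|l s' IH] t' //= reds redt lcp0.
  rewrite /finv /= rev_cons -cats1 /fact foldr_cat /= -/(fact _ _) -/(finv _).
  have -> : fpush (invl l) t' = invl l :: t'.
    case: t' lcp0 {redt} => //= l' t'; rewrite invlK.
    by rewrite eq_sym; case: eqP.
  rewrite IH //=; first by rewrite addnS.
  - exact: path_sorted reds.
  - case: t' lcp0 redt => //= l' t'; rewrite /freduced /= /fcompat invlK [l' == l]eq_sym.
    by case: eqP => //= _ _ ->.
  by case: s' reds {IH lcp0} => //= l' s' /andP[/negPf->].
elim: s t => [|l s IH] [|l' t] reds redt; try by rewrite nocancel ?addn0.
case: (eqVneq l l') => [ll'|ne]; last first.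
  have lcp0 : lcp (l :: s) (l' :: t) = 0 by rewrite /= (negPf ne).
  by rewrite nocancel ?lcp0 ?addn0.
rewrite -ll' /finv [rev _]rev_cons -cats1 /fact foldr_cat /= invlK !eqxx.
have := IH t (path_sorted reds) (path_sorted redt); rewrite /fact /finv /= => IHt.
  by rewrite addnS addSn doubleS addnS addnS IHt.
Qed.

Lemma flen_divl x y : flen ((x^-1 : F) * y)%g + (lcp (fval x) (fval y)).*2 = flen x + flen y.
Proof. by rewrite /flen fact_size ?fvalP. Qed.

Lemma flenV x : flen x^-1%g = flen x.
Proof. by rewrite /flen /= /finv size_rev size_map. Qed.

Lemma flenM x y : flen (x * y)%g <= flen x + flen y.
Proof.
have := flen_divl x^-1%g y; rewrite flenV invgK => <-.
by rewrite leq_addr.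
Qed.

(** By [flen_divl], the ultrametric inequality for the vertices c, ca, cab says that |ab| is at most
    |a| + |cab| - |ca| or at most |b| + |c| - |ca|. At a peak these are at most |a| and |b|. *)
Lemma flen_peak M c a b : flen a <= M -> flen b <= M ->
  flen c <= flen (c * a)%g -> flen (c * a * b)%g <= flen (c * a)%g ->
  flen (a * b)%g <= M.
Proof.
have := lcp_ultrametric (fval c) (fval (c * a)%g) (fval (c * a * b)%g).
have ca := flen_divl c (c * a)%g; rewrite mulKg in ca.
have cb := flen_divl (c * a)%g (c * a * b)%g; rewrite mulKg in cb.
have cab : flen (a * b)%g + (lcp (fval c) (fval (c * a * b)%g)).*2 =
    flen c + flen (c * a * b)%g.
  by rewrite -flen_divl -[(c * a * b)%g]mulgA mulKg.
move: ca cb cab; lia.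
Qed.

(** The vertex p separates x from y in the tree, so the geodesic from x to y passes through p. *)
Lemma flen_prefix p x y : prefix (fval p) (fval y) -> ~~ prefix (fval p) (fval x) ->
  flen ((p^-1 : F) * y)%g <= flen ((x^-1 : F) * y)%g.
Proof.
rewrite -!lcp_prefix -!/(flen _) => /eqP py npx.
have := flen_divl p y; have := flen_divl x y.
have := lcp_ultrametric (fval p) (fval y) (fval x).
have : lcp (fval p) (fval x) <= flen p by exact: lcp_size.
have : lcp (fval x) (fval y) <= flen x by exact: lcp_size.
by move: npx; rewrite py [lcp (fval y) _]lcpC; lia.
Qed.

Lemma felt_fval x : felt (fval x) = x.
Proof. by apply: val_inj; rewrite /= freduce_id ?fvalP. Qed.

Lemma flen_felt s : flen (felt s) <= size s.
Proof.
rewrite /flen /=; elim: s => //= l s; rewrite -!/(freduce _) => IH.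
by case: (freduce s) IH => [|l' t] //=; case: eqP => //= _; lia.
Qed.

Lemma felt_cat s t : felt (s ++ t) = (felt s * felt t)%g.
Proof.
apply: val_inj => /=; rewrite /freduce foldr_cat.
exact: esym (@fact_assoc _ s [::] (freduce t) isT (freduce_reduced t)).
Qed.
End Length.

(** * Short products along runs *)

Section TupleWords.
Variables (A : finType) (M : nat).
Local Notation F := (freegroup A).
Local Notation T := (M.-tuple (option (A * bool))).

(* Letters and blanks: every element of length at most M is hit, and the
   cardinal of T is a plain power. *)
Definition tword (t : T) : F := felt (pmap id t).

Lemma flen_tword t : flen (tword t) <= M.
Proof.
apply: leq_trans (flen_felt _) _; rewrite size_pmap.
by apply: leq_trans (count_size _ _) _; rewrite size_tuple.
Qed.

Lemma twordP (x : F) : flen x <= M -> exists t, tword t = x.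
Proof.
move=> xM; pose s := [seq Some l | l <- fval x] ++ nseq (M - flen x) None.
have sM : size s == M by rewrite size_cat size_map size_nseq subnKC.
exists (Tuple sM); rewrite -[RHS]felt_fval /tword /= pmap_cat; congr felt.
rewrite (_ : pmap id (nseq _ _) = [::]) ?cats0; last by elim: (_ - _).
by elim: (fval x) => //= l w ->.
Qed.

Lemma card_twords : #|{: T}| = (#|A|.*2.+1) ^ M.
Proof. by rewrite card_tuple card_option card_prod card_bool muln2. Qed.
End TupleWords.

Section Runs.
Variables (A : finType) (Q : finType).
Local Notation F := (freegroup A).

Inductive run (E : Q -> F -> Q -> Prop) : Q -> nat -> F -> Q -> Prop :=
| run0 p : run E p 0 1%g p
| runS p a r N v q : E p a r -> run E r N v q -> run E p N.+1 (a * v)%g q.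

Lemma run1 (E : Q -> F -> Q -> Prop) p a q : E p a q -> run E p 1 a q.
Proof. by move=> Ea; rewrite -[a]mulg1; apply: runS Ea (run0 _ _). Qed.

Lemma run_cat (E : Q -> F -> Q -> Prop) p N v r N' w q :
  run E p N v r -> run E r N' w q -> run E p (N + N') (v * w)%g q.
Proof.
elim=> [?|p1 a r1 N1 v1 q1 Ea _ IH] rw; first by rewrite mul1g.
by rewrite -mulgA addSn; apply: runS Ea (IH rw).
Qed.

Lemma sub_run (E E' : Q -> F -> Q -> Prop) p N v q :
  (forall p a q, E p a q -> E' p a q) -> run E p N v q -> run E' p N v q.
Proof. by move=> sE; elim=> [*|*]; [exact: run0 | apply: runS; eauto]. Qed.

Section Bound.
Variables (M : nat) (E : Q -> F -> Q -> Prop).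
Hypothesis E_short : forall p a q, E p a q -> flen a <= M.
Local Notation T := (M.-tuple (option (A * bool))).
Implicit Types Y : {set Q * T * Q}.

(** A monotone operator on a finite powerset; its least fixed point is the closure of the edges
    under those compositions that stay within length M. *)
Definition short_step Y : {set Q * T * Q} :=
  [set t | `[< E t.1.1 (tword t.1.2) t.2 >] ||
     [exists r, exists w1, exists w2, [&& (t.1.1, w1, r) \in Y, (r, w2, t.2) \in Y
        & (tword w1 * tword w2)%g == tword t.1.2]]].

Lemma short_step_mono : {homo short_step : X Y / X \subset Y}.
Proof.
move=> X Y /subsetP sXY; apply/subsetP => t; rewrite !inE => /orP[->//|].
move=> /existsP[r /existsP[w1 /existsP[w2 /and3P[/sXY X1 /sXY X2 e]]]].
apply/orP; right; apply/existsP; exists r; apply/existsP; exists w1.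
by apply/existsP; exists w2; rewrite X1 X2.
Qed.

Definition short p a q := exists2 w, tword w = a & (p, w, q) \in fixset short_step.

Lemma short_edge p a q : E p a q -> short p a q.
Proof.
move=> Ea; have [w wa] := twordP (E_short Ea); exists w => //.
rewrite -(fixsetK short_step_mono) inE; apply/orP; left; apply/asboolP.
by rewrite wa.
Qed.

Lemma shortM p a r b q : short p a r -> short r b q -> flen (a * b)%g <= M ->
  short p (a * b)%g q.
Proof.
move=> [w1 <- X1] [w2 <- X2] /twordP[w wE]; exists w => //.
rewrite -(fixsetK short_step_mono) inE; apply/orP; right.
apply/existsP; exists r; apply/existsP; exists w1; apply/existsP; exists w2.
by rewrite X1 X2 /= wE.
Qed.

Lemma short_flen p a q : short p a q -> flen a <= M.
Proof. by case=> w <- _; exact: flen_tword. Qed.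

(* The walk c, c a, ... has a peak, where two consecutive edges compose to a
   short one, or it moves away from 1 all the time. *)
Lemma run_peak c p a r N v q : short p a r -> flen c <= flen (c * a)%g ->
  run short r N v q ->
  run short p N (a * v)%g q \/ flen (c * a)%g <= flen (c * a * v)%g.
Proof.
move=> Ra ca rv; elim: rv c p a Ra ca => {r N v q} [r|r b s N v q Rb rv IH] c p a Ra ca.
  by right; rewrite mulg1.
case: (leqP (flen (c * a * b)%g) (flen (c * a)%g)) => [peak|/ltnW climb].
  left; rewrite mulgA; apply: runS rv; apply: (shortM Ra Rb).
  exact: flen_peak (short_flen Ra) (short_flen Rb) ca peak.
have [rbv|le] := IH (c * a)%g r b Rb climb.
  by left; apply: runS Ra rbv.
by right; apply: leq_trans climb _; rewrite mulgA.
Qed.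

(** Consider the walk 1, a, ab, ..., v. If it descends at ab, the first two edges merge. Otherwise
    [run_peak] either merges two later edges or gives |ab| <= |v| <= M, and again the first two
    merge. *)
Lemma run_shorten p N v q : run short p N.+2 v q -> flen v <= M -> run short p N.+1 v q.
Proof.
move=> rv; inversion rv as [|? a r ? v1 ? Ra rv1]; subst.
inversion rv1 as [|? b s ? v2 ? Rb rv2]; subst => vM.
have merge : flen (a * b)%g <= M -> run short p N.+1 (a * (b * v2))%g q.
  by move=> abM; rewrite mulgA; apply: runS rv2; exact: (shortM Ra Rb).
case: (leqP (flen a) (flen (a * b)%g)) => [climb|/ltnW drop]; last first.
  by apply/merge/(leq_trans drop); exact: short_flen Ra.
have [rbv|le] := run_peak Rb climb rv2; first exact: runS Ra rbv.
by apply/merge/(leq_trans le); rewrite -mulgA.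
Qed.

Lemma run_short p N v q : run E p N.+1 v q -> flen v <= M -> short p v q.
Proof.
move=> /(sub_run short_edge) + vM; elim: N => [|N IH] rv; last exact/IH/run_shorten.
inversion rv as [|? a r ? v1 ? Ra rv1]; subst; inversion rv1; subst.
by rewrite mulg1.
Qed.

(** A round of [short_step] composes two entries of the previous round, so it at most doubles the
    length of a run. *)
Lemma short_run k p w q : (p, w, q) \in iter k short_step set0 ->
  exists2 N, N <= 2 ^ k & run E p N (tword w) q.
Proof.
elim: k p w q => [|k IH] p w q; first by rewrite inE.
rewrite iterS inE => /orP[/asboolP Ew|]; first by exists 1; [rewrite expn_gt0 | exact: run1].
move=> /existsP[r /existsP[w1 /existsP[w2 /and3P[/IH[N1 le1 r1] /IH[N2 le2 r2] /eqP<-]]]].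
by exists (N1 + N2); [rewrite expnS mul2n -addnn leq_add | exact: run_cat r1 r2].
Qed.

Lemma run_bound p N v q : run E p N v q -> flen v <= M ->
  exists2 N', N' <= 2 ^ (#|Q| * #|A|.*2.+1 ^ M * #|Q|) & run E p N' v q.
Proof.
case: N => [|N] rv vM; first by exists 0.
(* [fixset] is the iterate of [short_step] from the empty set, with as many rounds as there are
   triples in Q * T * Q. *)
have [w <- /short_run] := run_short rv vM.
by rewrite !card_prod card_twords.
Qed.
End Bound.
End Runs.

(** * Bounded solutions *)

Section Solutions.
Variables (A : finType) (S : seq (freegroup A)) (m : nat).
Local Notation F := (freegroup A).
Local Notation W := (#|A|.*2.+1).
Hypothesis S_short : {in S, forall x, flen x <= m}.

Lemma gen1 : 1%g \in gen S. Proof. by case: (gen_group_closed S). Qed.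
Lemma genM x y : x \in gen S -> y \in gen S -> (x * y)%g \in gen S.
Proof. exact: group_closedM (gen_group_closed S) x y. Qed.
Lemma genV x : x \in gen S -> x^-1%g \in gen S.
Proof. exact: group_closedV (gen_group_closed S) x. Qed.

Definition gelt c : F := if odd c then (nth 1%g S c./2)^-1%g else nth 1%g S c./2.
Definition gprod y : F := (\prod_(c <- y) gelt c)%g.

Lemma gelt_gen c : gelt c \in gen S.
Proof.
have H : nth 1%g S c./2 \in gen S.
  case: (ltnP c./2 (size S)) => cS; last by rewrite nth_default // gen1.
  exact/gen_subset/mem_nth.
by rewrite /gelt; case: odd => //; exact: genV.
Qed.

Lemma gprod_gen y : gprod y \in gen S.
Proof.
rewrite /gprod; elim: y => [|c y IH]; first by rewrite big_nil gen1.
by rewrite big_cons; exact: genM (gelt_gen c) IH.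
Qed.

(** An automaton with a single state, whose runs spell products of generators and their inverses. *)
Definition gen_edge (_ : unit) (a : F) (_ : unit) : Prop := a \in S \/ a^-1%g \in S.

Lemma gen_edge_short p a q : gen_edge p a q -> flen a <= m.
Proof. by case=> /S_short //; rewrite flenV. Qed.

Lemma gen_edge_gen p a q : gen_edge p a q -> a \in gen S.
Proof. by case=> /gen_subset //; rewrite -{2}[a]invgK; exact: genV. Qed.

(** The labels of runs contain S and form a subgroup, inverses being read off the reversed run;
    [gen S] lies in every such subgroup. *)
Lemma gen_run x : x \in gen S -> exists N, run gen_edge tt N x tt.
Proof.
move=> /genP /(_ (fun x => `[< exists N, run gen_edge tt N x tt >])) H.
apply/asboolP; apply: H => [|a Sa]; last by apply/asboolP; exists 1; apply: run1; left.
have runV N a : run gen_edge tt N a tt -> exists N', run gen_edge tt N' a^-1%g tt.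
  elim=> [[]|[] b [] N1 v [] Eb _ [N' IH]]; first by exists 0; rewrite invg1; exact: run0.
  exists (N' + 1); rewrite invgM; apply: run_cat IH (run1 _).
  by case: Eb => Sb; [right; rewrite invgK | left].
split=> [|a b /asboolP[N ra] /asboolP[N' /runV[N2 rb]]].
  by apply/asboolP; exists 0; exact: run0.
by apply/asboolP; exists (N + N2); exact: run_cat ra rb.
Qed.

Lemma run_gprod p N x q : run gen_edge p N x q ->
  exists y, [/\ size y = N, all (fun c => c < (size S).*2) y & gprod y = x].
Proof.
elim=> [?|p1 a r1 N1 v q1 Ea _ [y [sy ally <-]]].
  by exists [::]; split=> //; rewrite /gprod big_nil.
have [c cS <-] : exists2 c, c < (size S).*2 & gelt c = a.
  case: Ea => Sa.
    exists (index a S).*2; first by rewrite ltn_double index_mem.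
    by rewrite /gelt odd_double doubleK nth_index.
  exists (index a^-1%g S).*2.+1; first by rewrite ltn_Sdouble index_mem.
  by rewrite /gelt /= odd_double /= uphalf_double nth_index // invgK.
exists (c :: y); rewrite /= sy cS ally; split=> //.
by rewrite /gprod big_cons.
Qed.

(** The bound of [run_bound] for an automaton with one state. *)
Definition gen_bound M := 2 ^ (W ^ M).

Lemma gen_short M x : m <= M -> x \in gen S -> flen x <= M ->
  exists y, [/\ size y <= gen_bound M, all (fun c => c < (size S).*2) y & gprod y = x].
Proof.
move=> mM /gen_run[N rx] xM.
have short p a q : gen_edge p a q -> flen a <= M.
  by move=> /gen_edge_short am; exact: leq_trans am mM.
have [N' + /run_gprod[y [sy ally yx]]] := run_bound short rx xM.
by rewrite card_unit mul1n muln1 -sy; exists y.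
Qed.

(* Some partial product of the generators jumps over the prefix. *)
Lemma gen_prefix p x : x \in gen S -> prefix (fval p) (fval x) ->
  exists2 s : F, flen s <= m & (p * s)%g \in gen S.
Proof.
move=> /gen_run[N rx].
have main q q' c : run gen_edge q N x q' -> c \in gen S -> ~~ prefix (fval p) (fval c) ->
    prefix (fval p) (fval (c * x)%g) -> exists2 s : F, flen s <= m & (p * s)%g \in gen S.
  move=> r; elim: r c => {rx N x q q'} [q|q a q' N v q2 Ea _ IH] c cS npc.
    by rewrite mulg1 (negPf npc).
  have caS := genM cS (gen_edge_gen Ea).
  case: (boolP (prefix (fval p) (fval (c * a)%g))) => [pca _|npca]; last first.
    by rewrite mulgA; exact: IH.
  exists (p^-1 * (c * a))%g; last by rewrite mulVKg.
  apply: leq_trans (flen_prefix pca npc) _.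
  by rewrite mulKg; exact: gen_edge_short Ea.
move=> px; case: (boolP (prefix (fval p) (fval (1%g : F)))) => [p1|np1].
  have -> : p = 1%g by apply: val_inj => /=; move: p1; rewrite prefixs0 => /eqP.
  by exists 1%g; rewrite // mulg1; exact: gen1.
by apply: (main _ _ 1%g rx gen1 np1); rewrite mul1g.
Qed.


(** * Products with constants and slots for subgroup elements *)

Local Notation L := (A * bool)%type.

(* A shape lists the factors of a product: Some g is the constant g and None is
   a slot for a nontrivial element of gen S. *)
Definition fits (o : option F) (w : F) : Prop :=
  if o is Some g then w = g else w \in gen S /\ w <> 1%g.

Definition fits_bounded B (o : option F) (w : F) : Prop :=
  if o is Some g then w = g
  else w <> 1%g /\
    exists y, [/\ size y <= B, all (fun c => c < (size S).*2) y & gprod y = w].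

Fixpoint all2P (T U : Type) (P : T -> U -> Prop) s t : Prop :=
  match s, t with
  | [::], [::] => True
  | x :: s', y :: t' => P x y /\ all2P P s' t'
  | _, _ => False
  end.

Lemma sub_all2P (T U : Type) (P P' : T -> U -> Prop) s t :
  (forall x y, P x y -> P' x y) -> all2P P s t -> all2P P' s t.
Proof. by move=> PP'; elim: s t => [|x s IH] [|y t] //= [/PP' ? /IH ?]. Qed.

Definition wprod (ws : seq F) : F := (\prod_(w <- ws) w)%g.

Lemma fits_boundedW B B' o w : B <= B' -> fits_bounded B o w -> fits_bounded B' o w.
Proof.
move=> BB'; case: o => //= -[w1 [y [sy ally yw]]]; split=> //.
by exists y; split=> //; exact: leq_trans sy BB'.
Qed.

Section Shape.
Variables (sh : seq (option F)) (M : nat).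
Hypothesis M_gt0 : 0 < M.
Hypothesis sh_short : forall g, Some g \in sh -> flen g <= M.

(* The position in the shape and, inside a slot, a short element s such that
   the product of the letters read so far lies in (gen S) s^-1, and the last
   of these letters. *)
Definition state := ('I_(size sh).+1 * m.-tuple (option L) * option L)%type.

Definition blank : m.-tuple (option L) := nseq_tuple m None.

Definition follows (last : option L) (t : word A) :=
  if last is Some l then path (@fcompat A) l t else freduced t.

(** If x is the part of the slot read so far and x s lies in [gen S], then the condition on s^-1 a
    s' says that x a s' lies there too. A slot entered and left with blank s thus spells an element
    of [gen S]. It is nontrivial because its letters follow each other reducedly and the exit edge,
    labelled 1, demands that some letter was read. *)
Definition shape_edge (p : state) (a : F) (q : state) : Prop :=
  match drop p.1.1 sh with
  | [::] => False
  | Some g :: _ => [/\ p.1.2 = blank, p.2 = None, a = g &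
      [/\ q.1.1 = p.1.1.+1 :> nat, q.1.2 = blank & q.2 = None]]
  | None :: _ =>
      (exists l, [/\ a = felt [:: l], follows p.2 [:: l], q.1.1 = p.1.1, q.2 = Some l
         & ((tword p.1.2 : F)^-1 * (a * tword q.1.2))%g \in gen S]) \/
      [/\ p.1.2 = blank, p.2 <> None, a = 1%g &
      [/\ q.1.1 = p.1.1.+1 :> nat, q.1.2 = blank & q.2 = None]]
  end.

Lemma shape_edge_short p a q : shape_edge p a q -> flen a <= M.
Proof.
rewrite /shape_edge; case E: (drop _ _) => [|[g|] s'] //.
  move=> [_ _ -> _]; apply: sh_short; rewrite -(cat_take_drop p.1.1 sh) E.
  by rewrite mem_cat inE eqxx orbT.
by case=> [[l [-> _ _ _ _]]|[_ _ -> _]].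
Qed.

Lemma tword_blank : tword blank = 1%g.
Proof. by apply: val_inj; rewrite /tword /=; elim: (m). Qed.

Lemma felt_nil : felt [::] = 1%g :> F. Proof. exact: val_inj. Qed.

Lemma felt_cons l t : felt (l :: t) = (felt [:: l] * felt t)%g :> F.
Proof. exact: (felt_cat [:: l] t). Qed.

(** Induction on the unread part t of w = p ++ t; [gen_prefix] supplies a short s for each longer
    prefix. *)
Lemma slot_run (i : 'I_(size sh).+1) sh' w : drop i sh = None :: sh' -> w \in gen S ->
  forall t p s last, fval w = p ++ t -> (felt p * tword s)%g \in gen S ->
  (t = [::] -> s = blank) -> follows last t -> last <> None \/ t <> [::] ->
  exists N last', last' <> None /\
    run shape_edge (i, s, last) N (felt t) (i, blank, last').
Proof.
move=> di wS; elim=> [|l t IH] p s last wpt ps ts fol ne.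
  exists 0, last; split; first by case: ne.
  by rewrite felt_nil (ts erefl); exact: run0.
have wpt' : fval w = (p ++ [:: l]) ++ t by rewrite -catA.
(* After the last letter the prefix is w itself, which lies in [gen S], so s' can be blank. *)
have [s' ps' ts'] : exists2 s', (felt (p ++ [:: l]) * tword s')%g \in gen S &
    t = [::] -> s' = blank.
  case: t {IH wpt fol ne ts} wpt' => [|l' t] wpt'.
    exists blank => //; rewrite tword_blank mulg1.
    by move: wpt'; rewrite cats0 => <-; rewrite felt_fval.
  have red : freduced (p ++ [:: l]).
    by have := fvalP w; rewrite wpt' => /cat_sorted2[].
  have [|s0 s0m ps0] := gen_prefix (p := FreeGroup red) wS.
    by rewrite /= wpt' prefix_prefix.
  have [s' s'E] := twordP s0m; exists s' => //.
  rewrite s'E; suff -> : felt (p ++ [:: l]) = FreeGroup red by [].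
  by apply: val_inj; rewrite /= freduce_id.
have fol' : follows (Some l) t by case: last fol {ne} => [l0|] //= /andP[].
have ne1 : Some l <> None \/ t <> [::] by left.
have [N [last' [ne' rt]]] := IH _ s' (Some l) wpt' ps' ts' fol' ne1.
exists N.+1, last'; split=> //; rewrite felt_cons; apply: runS rt.
rewrite /shape_edge /= di; left; exists l; split=> //.
  by case: last fol {ne} => [l0|] //= /andP[-> _].
rewrite [X in X \in _](_ : _ = (felt p * tword s)^-1 * (felt (p ++ [:: l]) * tword s'))%g.
  exact: genM (genV ps) ps'.
by rewrite felt_cat invgM -!mulgA mulKg.
Qed.

Lemma drop_next (i : 'I_(size sh).+1) o sh' : drop i sh = o :: sh' ->
  exists2 i' : 'I_(size sh).+1, i' = i.+1 :> nat & drop i' sh = sh'.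
Proof.
move=> di; have ilt : i.+1 < (size sh).+1.
  by rewrite ltnS -subn_gt0 -size_drop di.
by exists (Ordinal ilt); rewrite //= -add1n -drop_drop di /= drop0.
Qed.

Lemma drop_last (i : 'I_(size sh).+1) : drop i sh = [::] -> i = ord_max.
Proof.
move=> /(congr1 size); rewrite size_drop /= => /eqP; rewrite subn_eq0 => le.
by apply: val_inj; apply/eqP; rewrite eqn_leq le -ltnS ltn_ord.
Qed.

Lemma shape_run (i : 'I_(size sh).+1) ws : all2P fits (drop i sh) ws ->
  exists N, run shape_edge (i, blank, None) N (wprod ws) (ord_max, blank, None).
Proof.
elim: ws i => [|w ws IH] i; case di: (drop i sh) => [|o sh'] //=.
  by move=> _; exists 0; rewrite /wprod big_nil (drop_last di); exact: run0.
move=> [ow wsok]; have [i' i'E di'] := drop_next di.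
have [|N rws] := IH i'; first by rewrite di'.
rewrite /wprod big_cons -/(wprod ws).
case: o di ow => [g|] di /= => [->|[wS wn1]].
  by exists N.+1; apply: runS rws; rewrite /shape_edge /= di.
have [|||||N1 [last' [ne rw]]] :=
  slot_run (s := blank) (last := None) di wS (t := fval w) (p := [::]).
- by [].
- by rewrite tword_blank mulg1 felt_nil; exact: gen1.
- by [].
- exact: fvalP.
- by right=> w0; apply: wn1; exact: val_inj.
exists (N1 + N.+1); rewrite felt_fval in rw; apply: run_cat rw _.
(* One more edge, labelled 1, leaves the slot. *)
rewrite -[wprod ws]mul1g; apply: runS rws.
by rewrite /shape_edge /= di; right.
Qed.

(** Reading a letter l in a slot uses an element s^-1 l s' of [gen S], of length at most 2m + 1; B
    bounds the number of generators that express it. *)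
Let B := gen_bound m.*2.+1.

(** Invariant for decomposing a run from its end: v is the product of the remaining factors. Inside
    a slot, t is the rest of the slot's word and y expresses s^-1 t by generators, with B generators
    allowed per edge. *)
Definition tail_ok N (q : state) (v : F) : Prop :=
  match drop q.1.1 sh with
  | [::] => v = 1%g
  | Some g :: sh' => exists ws, all2P (fits_bounded (N * B)) sh' ws /\ v = (g * wprod ws)%g
  | None :: sh' => exists t ws y,
      [/\ follows q.2 t /\ (q.2 <> None \/ t <> [::]), size y <= N * B,
          all (fun c => c < (size S).*2) y & gprod y = ((tword q.1.2 : F)^-1 * felt t)%g] /\
      (all2P (fits_bounded (N * B)) sh' ws /\ v = (felt t * wprod ws)%g)
  end.

Lemma tail_ok_fits N q v : tail_ok N q v -> q.1.2 = blank -> q.2 = None ->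
  exists2 ws, all2P (fits_bounded (N * B)) (drop q.1.1 sh) ws & v = wprod ws.
Proof.
rewrite /tail_ok; case: (drop _ _) => [|[g|] sh'].
- by move=> -> _ _; exists [::]; rewrite // /wprod big_nil.
- by move=> [ws [ok ->]] _ _; exists (g :: ws); rewrite // /wprod big_cons.
move=> [t [ws [y [[[fol ne] sy ally yt] [ok ->]]]]] s1 q2.
exists (felt t :: ws); rewrite /wprod ?big_cons //=; split=> //; split.
  move: fol ne; rewrite q2 /= => red [//|tn0] /(congr1 val) /=.
  by rewrite freduce_id.
by exists y; rewrite yt s1 tword_blank invg1 mul1g.
Qed.

(** Prepending a letter l turns s'^-1 t into s^-1 l t = (s^-1 l s') (s'^-1 t), so [gen_short] adds
    at most B generators to y. *)
Lemma run_tail_ok q N v q' : run shape_edge q N v q' -> q' = (ord_max, blank, None) ->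
  tail_ok N q v.
Proof.
elim=> [p ->|p a r N1 v1 q1 Ea _ IH /IH {IH} ok]; first by rewrite /tail_ok /= drop_size.
have le1 o w : fits_bounded (N1 * B) o w -> fits_bounded (N1.+1 * B) o w.
  by apply: fits_boundedW; rewrite leq_mul2r leqnSn orbT.
have next o sh' : drop p.1.1 sh = o :: sh' ->
    [/\ r.1.1 = p.1.1.+1 :> nat, r.1.2 = blank & r.2 = None] ->
    exists2 ws, all2P (fits_bounded (N1.+1 * B)) sh' ws & v1 = wprod ws.
  move=> dp [rE s1 l0]; have [ws wsok vE] := tail_ok_fits ok s1 l0; exists ws => //.
  have [i' i'E di'] := drop_next dp.
  by rewrite -di' i'E -rE; apply: sub_all2P wsok.
move: Ea; rewrite /shape_edge /tail_ok; case dp: (drop _ _) => [|[g|] sh'] //.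
  by move=> [_ _ -> /(next _ _ dp)[ws wsok ->]]; exists ws.
case=> [[l [-> fol rp rl cS]]|[s1 ne -> /(next _ _ dp)[ws wsok ->]]]; last first.
  exists [::], ws, [::]; rewrite s1 tword_blank; split; split=> //.
    by split; [case: (p.2) | left].
  by rewrite /gprod big_nil invg1 mul1g felt_nil.
move: ok; rewrite /tail_ok rp dp => -[t [ws [y [[[fol' ne] sy ally yt] [ok ->]]]]].
have [||y0 [sy0 ally0 y0E]] := gen_short (M := m.*2.+1) _ cS.
- by lia.
- apply: leq_trans (flenM _ _) _; rewrite flenV.
  have := flenM (felt [:: l]) (tword r.1.2); have := flen_felt [:: l].
  have := flen_tword p.1.2; have := flen_tword r.1.2; rewrite /=; lia.
exists (l :: t), ws, (y0 ++ y); split; split.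
- split; last by right.
  rewrite rl in fol'; by case: (p.2) fol => [l0 /andP[/= -> _]|_]; exact: fol'.
- by rewrite size_cat mulSn leq_add.
- by rewrite all_cat ally0.
- rewrite /gprod big_cat /= -!/(gprod _) y0E yt.
  by rewrite (felt_cons l t) -!mulgA mulVKg.
- exact: sub_all2P ok.
- by rewrite (felt_cons l t) mulgA.
Qed.

(** Q is the number of states. The power of 2 bounds the length of a run by [run_bound], and each
    edge costs at most B generators. *)
Definition fill_bound :=
  let Q := (size sh).+1 * W ^ m * W in 2 ^ (Q * W ^ M * Q) * B.

(** A filling with product 1 is a run whose label has length 0, so [run_bound] replaces it by a
    bounded run, which [run_tail_ok] reads back as a filling of the same shape. *)
Lemma fill_short ws : all2P fits sh ws -> wprod ws = 1%g ->
  exists2 ws', all2P (fits_bounded fill_bound) sh ws' & wprod ws' = 1%g.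
Proof.
have := @shape_run ord0 ws; rewrite drop0 => H /H[N rws] ws1; rewrite ws1 in rws.
have [N' N'le /run_tail_ok /(_ erefl) /tail_ok_fits] := run_bound shape_edge_short rws (leq0n _).
rewrite /= drop0 => /(_ erefl erefl)[ws' ok /esym ws'1]; exists ws' => //.
apply: sub_all2P ok => o w; apply: fits_boundedW; rewrite leq_mul2r.
apply/orP; right; apply: leq_trans N'le _.
by rewrite !card_prod card_ord card_tuple card_option card_prod card_bool muln2.
Qed.

End Shape.
End Solutions.

(** * Cyclically reduced words *)

Section CyclicWords.
Variable G : groupType.
Implicit Types s : seq (letter G).

(** Apart from the nontriviality of the coefficients, being cyclically reduced depends only on the
    pattern, so coefficients may be exchanged for smaller ones. *)
Definition pattern (a : letter G) : option bool := if a is inl e then Some e else None.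

Definition pcompat (a b : option bool) :=
  match a, b with
  | Some e, Some e' => e == e'
  | None, None => false
  | _, _ => true
  end.

Definition good_pattern p := cycle pcompat p && isSome (head None p).

Lemma compatE (a b : letter G) : compat a b = pcompat (pattern a) (pattern b).
Proof. by case: a b => [?|?] [?|?]. Qed.

(* Cyclically reduced words whose first letter is x or x^-1 *)
Definition good s := all (@nontriv G) s && good_pattern (map pattern s).

Lemma goodP s : reflect
  [/\ all (@nontriv G) s, cycle (@compat G) s & if s is inl _ :: _ then true else false] (good s).
Proof.
apply: (iffP andP) => [[ns /andP[cs hs]]|[ns cs hs]]; split=> //.
- by move: cs; rewrite cycle_map; apply: sub_cycle => a b; rewrite /= -compatE.
- by case: s hs {ns cs} => [|[e|h] s].
rewrite /good_pattern cycle_map; apply/andP; split; last by case: s hs {ns cs} => [|[e|h] s].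
by apply: sub_cycle cs => a b; rewrite /= -compatE.
Qed.

Lemma good_reduced s : good s -> reduced s.
Proof.
case/goodP => ns cs _; rewrite /reduced ns /=.
by case: s cs {ns} => //= a s; rewrite rcons_path => /andP[].
Qed.

(** The first letter is x or x^-1, and the last one is either the same letter or a coefficient, so
    the recursion stops at once. *)
Lemma good_cycred k s : good s -> cycred_rec k s = s.
Proof.
case/goodP => _; case: k s => [|k] [|[e|h] [|b t]] //= /andP[_].
by rewrite rcons_path => /andP[_]; case: (last b t) => [e'|h] //=; rewrite eq_sym => ->.
Qed.

(** No two coefficients are adjacent and the first letter is x or x^-1, so there are at most as many
    coefficients as variables. A word that starts with a coefficient may have one more. *)
Lemma good_size s : good s -> size s <= (count (@is_var G) s).*2.
Proof.
suff H t : sorted (@compat G) t ->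
    size t <= (count (@is_var G) t).*2 + (if t is inr _ :: _ then 1 else 0).
  move=> gs; have := H s; have /andP[_ ->] := good_reduced gs.
  by case/goodP: gs => _ _; case: s => [|[e|h] s] //=; rewrite addn0 => _ ->.
elim: t => //= a t IH pt; have := IH (path_sorted pt).
by case: a t pt {IH} => [e|h] [|[e'|h'] t] //=; lia.
Qed.

Variables (K : groupType) (f : UMagmaMorphism.type G K) (g : K).
Local Notation ev s := (\prod_(a <- s) letter_eval f g a)%g.

(** The cyclic reduction may begin with a coefficient; it is then rotated. Cancelling or merging the
    ends and rotating only conjugate the value, which therefore stays 1. *)
Lemma cycred_good k s : reduced s -> size s <= k -> ev s = 1%g ->
  0 < count (@is_var G) (cycred_rec k s) ->
  exists s', [/\ good s', count (@is_var G) s' = count (@is_var G) (cycred_rec k s)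
    & ev s' = 1%g].
Proof.
elim: k s => [|k IH] s reds; first by case: s reds.
case: s reds => [|a [|b t]] reds // sk ev1.
  move=> /= c; exists [:: a]; split=> //.
  by apply/goodP; case: a c reds ev1 {sk} => [e|h] //; split=> //=; rewrite eqxx.
rewrite [cycred_rec _ _]/=; set m := belast b t; set z := last b t.
have sE : a :: b :: t = a :: rcons m z by rewrite -lastI.
have mk : size m <= k by rewrite size_belast; move: sk => /=; lia.
rewrite sE in reds ev1 *.
have [/= /andP[na nm] pm] := andP reds.
rewrite all_rcons in nm; case/andP: nm => nz nm.
have redm : reduced m.
  rewrite /reduced nm; move: pm; rewrite rcons_path => /andP[+ _].
  by case: (m) => //= c m' /andP[].
have cyc : compat z a -> cycle (@compat G) (a :: rcons m z).
  by move=> za; rewrite /= rcons_path pm last_rcons.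
have evE : (letter_eval f g a * (ev m * letter_eval f g z) = 1)%g.
  by move: ev1; rewrite big_cons big_rcons.
have cyc_ev (x y v : K) : (x * (v * y) = 1 -> v * (y * x) = 1)%g.
  move=> /(congr1 (fun u => x^-1 * u * x)%g); rewrite mulKg mulgA => ->.
  by rewrite mulg1 mulVg.
have evm : (letter_eval f g z * letter_eval f g a = 1 -> ev m = 1)%g.
  by move=> za; have := cyc_ev _ _ _ evE; rewrite za mulg1.
have rec (c : 0 < count (@is_var G) (cycred_rec k m)) :
    (letter_eval f g z * letter_eval f g a = 1)%g ->
    exists s', [/\ good s', count (@is_var G) s' = count (@is_var G) (cycred_rec k m)
      & ev s' = 1%g] by move=> za; exact: IH redm mk (evm za) c.
case: a na pm sk sE reds ev1 cyc evE evm rec => [e|h] na pm sk sE reds ev1 cyc evE evm rec;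
  case zE: (z) nz => [e'|h'] nz; rewrite ?zE in pm ev1 cyc evE evm rec *.
- case: eqP => [ee'|ne] c.
    exists (inl e :: rcons m (inl e')); split=> //; apply/goodP; split.
    + by rewrite /= all_rcons nm.
    + by apply: cyc; rewrite /= ee'.
    + by [].
  apply: rec c _ => /=; case: e e' ne {pm sk sE reds ev1 cyc evE evm zE na nz} => [] [] //= _.
    by rewrite mulgV.
  by rewrite mulVg.
- move=> _; exists (inl e :: rcons m (inr h')); split=> //; apply/goodP; split=> //.
    by rewrite /= all_rcons nm andbT.
  exact: cyc.
(* The leading coefficient moves to the end; the next letter is then x or x^-1, since coefficients
   are not adjacent. *)
- move=> _; exists (rcons m (inl e') ++ [:: inr h]); split.
  + apply/goodP; split.
    * by rewrite all_cat all_rcons nm /= andbT; move: na.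
    * by have := cyc isT; rewrite -(rot_cycle 1) /rot /= drop0 take0.
    * by case: (m) pm => [|[e0|h0] m'].
  + by rewrite count_cat addnC.
  + by rewrite big_cat big_rcons big_seq1 /= -mulgA; exact: cyc_ev evE.
case: eqP => [h1|hn1] c.
  by apply: rec c _ => /=; rewrite -gmulfM h1 gmulf1.
have mhead : if m is inl _ :: _ then true else false.
  by case: (m) pm => [|[e0|h0] m'].
exists (rcons m (inr (h' * h)%g)); split=> //.
  apply/goodP; split.
  - by rewrite all_rcons nm /= andbT; apply/eqP.
  - case: (m) pm mhead => [|[e0|h0] m'] //=.
    by rewrite rcons_path => /andP[pm lm] _; rewrite !rcons_path pm last_rcons andbT.
  - by case: (m) mhead => [|[e0|h0] m'].
by rewrite big_rcons /= gmulfM; exact: cyc_ev evE.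
Qed.
End CyclicWords.

(** * Words as lists of numbers *)

(* The letter a_i is the number 2i and its inverse is 2i + 1. *)
Definition ninv c := if odd c then c.-1 else c.+1.
Definition npush c s :=
  if ~~ nilp s && (head 0 s == ninv c) then behead s else c :: s.
Definition nreduce s := foldr npush [::] s.
Definition ninvw s := rev (map ninv s).

Lemma computable_ninv : computable (fun c : unit * nat => ninv c.2).
Proof. by rewrite /ninv; cmp_lauto. Qed.
#[local] Hint Resolve computable_ninv : computabledb.
Lemma computable_npush : computable (fun c : unit * nat * seq nat => npush c.1.2 c.2).
Proof. by rewrite /npush; cmp_lauto. Qed.
#[local] Hint Resolve computable_npush : computabledb.
Lemma computable_nreduce : computable (fun c : unit * seq nat => nreduce c.2).
Proof. by rewrite /nreduce; cmp_lauto. Qed.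
Lemma computable_ninvw : computable (fun c : unit * seq nat => ninvw c.2).
Proof. by rewrite /ninvw; cmp_lauto. Qed.
#[local] Hint Resolve computable_nreduce computable_ninvw : computabledb.
Lemma computable_decode : computable (fun c : unit * nat => CodeSeq.decode c.2).
Proof.
have [P HP] : computable (fun c : unit * nat => c.2) by cmp_auto.
exists P => c; have := HP c; congr computes.
by rewrite /en /enc_seq /en /enc_nat map_id CodeSeq.decodeK.
Qed.
#[local] Hint Resolve computable_decode : computabledb.

(* Generators are numbered like letters.  A candidate is a list of numbers where
   0 is x, 1 is x^-1 and c + 2 is the product of the generators listed by the
   code c; [nletters] turns it into the codes of the letters of an equation. *)
Definition ngen (gens : seq (seq nat)) c :=
  if odd c then ninvw (nth [::] gens c./2) else nth [::] gens c./2.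
Definition nhelt gens y := nreduce (flatten (map (ngen gens) y)).
Definition nletter gens a :=
  if a <= 1 then a else (en (nhelt gens (CodeSeq.decode (a - 2)))).+2.
Definition nletters gens k := map (nletter gens) (CodeSeq.decode k).

(** Here a is a letter code in the sense of [code_letter], no longer an entry of a candidate: c + 2
    is the coefficient whose reduced word has code c. *)
Definition nword u a :=
  if a == 0 then u else if a == 1 then ninvw u else CodeSeq.decode (a - 2).
Definition neval u W := nreduce (flatten (map (nword u) W)).
Definition ncompat a b := if a <= 1 then if b <= 1 then a == b else true else b <= 1.
(* The accumulator is 0 after a failure, and p + 1 if the last letter was p. *)
Definition ncycle W :=
  0 < foldl (fun p b => if p == 0 then 0 else if ncompat p.-1 b then b.+1 else 0)
        (head 0 W).+1 (behead W ++ [:: head 0 W]).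
Definition ndegree W := foldr (fun a m => if a <= 1 then m.+1 else m) 0 W.
(** The empty word has code 0, so 2 is the code of the trivial coefficient. *)
Definition nnontriv W := foldr (fun a b => ~~ (a == 2) && b) true W.
Definition nvalid u d W :=
  (~~ nilp W && (head 0 W <= 1)) && ncycle W && nnontriv W && (ndegree W == d)
  && nilp (neval u W).

Lemma computable_ngen : computable (fun c : unit * seq (seq nat) * nat => ngen c.1.2 c.2).
Proof. by rewrite /ngen; cmp_lauto. Qed.
#[local] Hint Resolve computable_ngen : computabledb.
Lemma computable_nhelt : computable (fun c : unit * seq (seq nat) * seq nat => nhelt c.1.2 c.2).
Proof. by rewrite /nhelt; cmp_lauto. Qed.
#[local] Hint Resolve computable_nhelt : computabledb.
Lemma computable_nletter : computable (fun c : unit * seq (seq nat) * nat => nletter c.1.2 c.2).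
Proof. by rewrite /nletter; cmp_lauto; apply: computable_en; cmp_lauto. Qed.
#[local] Hint Resolve computable_nletter : computabledb.
Lemma computable_nletters : computable (fun c : unit * seq (seq nat) * nat => nletters c.1.2 c.2).
Proof. by rewrite /nletters; cmp_lauto. Qed.
#[local] Hint Resolve computable_nletters : computabledb.
Lemma computable_nword : computable (fun c : unit * seq nat * nat => nword c.1.2 c.2).
Proof. by rewrite /nword; cmp_lauto. Qed.
#[local] Hint Resolve computable_nword : computabledb.
Lemma computable_neval : computable (fun c : unit * seq nat * seq nat => neval c.1.2 c.2).
Proof. by rewrite /neval; cmp_lauto. Qed.
Lemma computable_ncompat : computable (fun c : unit * nat * nat => ncompat c.1.2 c.2).
Proof. by rewrite /ncompat; cmp_lauto. Qed.
#[local] Hint Resolve computable_neval computable_ncompat : computabledb.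
Lemma computable_ncycle : computable (fun c : unit * seq nat => ncycle c.2).
Proof. by rewrite /ncycle; cmp_lauto. Qed.
Lemma computable_ndegree : computable (fun c : unit * seq nat => ndegree c.2).
Proof. by rewrite /ndegree; cmp_lauto. Qed.
Lemma computable_nnontriv : computable (fun c : unit * seq nat => nnontriv c.2).
Proof. by rewrite /nnontriv; cmp_lauto. Qed.
#[local] Hint Resolve computable_ncycle computable_ndegree computable_nnontriv : computabledb.
Lemma computable_nvalid :
  computable (fun c : unit * seq nat * nat * seq nat => nvalid c.1.1.2 c.1.2 c.2).
Proof. by rewrite /nvalid; cmp_lauto. Qed.
#[local] Hint Resolve computable_nvalid : computabledb.

(** * Agreement of the numerical functions with the group operations *)

Section Numbering.
Variable n : nat.
Local Notation F := (freegroup 'I_n).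
Implicit Types (s t u : word 'I_n).

Definition nl (l : 'I_n * bool) : nat := (nat_of_ord l.1).*2 + nat_of_bool l.2.

Lemma odd_nl l : odd (nl l) = l.2.
Proof. by rewrite oddD odd_double oddb. Qed.

Lemma nl_inj : injective nl.
Proof.
move=> l l' e; have e2 := congr1 odd e; rewrite !odd_nl in e2.
case: l l' e e2 => [i b] [j c] /= + e2; rewrite /nl /= e2 => /addIn /double_inj ij.
by congr pair; exact: val_inj.
Qed.

Lemma ninv_nl l : ninv (nl l) = nl (invl l).
Proof. by rewrite /ninv odd_nl; case: l => i []; rewrite /nl /=; lia. Qed.

Lemma nreduce_nl s : nreduce (map nl s) = map nl (freduce s).
Proof.
elim: s => //= l s ->; case: (freduce s) => //= l' t; rewrite /npush /= ninv_nl.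
by rewrite (inj_eq nl_inj); case: eqP.
Qed.

Lemma ninvw_nl s : ninvw (map nl s) = map nl (finv s).
Proof.
rewrite /ninvw /finv map_rev -!map_comp; congr rev.
by apply: eq_map => l; exact: ninv_nl.
Qed.

Lemma felt_finv s : felt (finv s) = (felt s)^-1%g :> F.
Proof.
elim: s => [|l s IH]; first exact: val_inj.
rewrite /finv /= rev_cons -cats1 felt_cat -/(finv s) IH [in RHS]felt_cons invgM.
by congr (_ * _)%g; exact: val_inj.
Qed.

Lemma nreduce_flatten (T : Type) (f : T -> word 'I_n) (s : seq T) :
  nreduce (flatten [seq map nl (f x) | x <- s]) =
  map nl (fval (\prod_(x <- s) felt (f x))%g).
Proof.
have -> : flatten [seq map nl (f x) | x <- s] = map nl (flatten (map f s)).
  by elim: s => //= x s ->; rewrite map_cat.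
suff -> : (\prod_(x <- s) felt (f x))%g = felt (flatten (map f s)) by rewrite nreduce_nl.
elim: s => [|x s IH]; first by rewrite big_nil felt_nil.
by rewrite big_cons /= felt_cat IH.
Qed.

Variables (S : seq (word 'I_n)).
Let fS : seq F := map felt S.
Let H : groupClosed F := gen_group fS.
Let gens : seq (seq nat) := map (map nl) S.

Definition genw c : word 'I_n := if odd c then finv (nth [::] S c./2) else nth [::] S c./2.

Lemma ngenE c : ngen gens c = map nl (genw c).
Proof.
rewrite /ngen /genw /gens; have -> : nth [::] (map (map nl) S) c./2 = map nl (nth [::] S c./2).
  case: (ltnP c./2 (size S)) => cS; first by rewrite (nth_map [::]).
  by rewrite !nth_default ?size_map.
by case: odd; rewrite // ninvw_nl.
Qed.

Lemma felt_genw c : felt (genw c) = gelt fS c.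
Proof.
rewrite /gelt /genw; have -> : nth 1%g fS c./2 = felt (nth [::] S c./2).
  case: (ltnP c./2 (size S)) => cS; first by rewrite (nth_map [::]).
  by rewrite !nth_default ?size_map // felt_nil.
by case: odd; rewrite // felt_finv.
Qed.

Lemma nheltE y : nhelt gens y = map nl (fval (gprod fS y)).
Proof.
rewrite /nhelt (eq_map ngenE) nreduce_flatten; congr map; congr (fval _).
by apply: eq_bigr => c _; exact: felt_genw.
Qed.

Definition hletter (a : nat) : letter (subgroup H) :=
  if a <= 1 then inl (a == 1)
  else inr (@Subgroup _ H (gprod fS (CodeSeq.decode (a - 2))) (gprod_gen fS _)).

Lemma nletterE a : nletter gens a = code_letter (hletter a).
Proof.
rewrite /nletter /hletter; case: ifP; first by case: a => [|[]].
by rewrite nheltE /= /code_word /en /enc_seq -map_comp.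
Qed.

Variable u : word 'I_n.
Let g : F := felt u.
Local Notation ev s :=
  (\prod_(a <- s) letter_eval (val : subgroup H -> F) g a)%g.
Implicit Type w : seq (letter (subgroup H)).

Definition letterw (a : letter (subgroup H)) : word 'I_n :=
  match a with inl e => if e then finv u else u | inr h => fval (val h) end.

Lemma nwordE a : nword (map nl u) (code_letter a) = map nl (letterw a).
Proof.
case: a => [[]|h] //=; first by rewrite /nword /= ninvw_nl.
by rewrite /nword /= subn2 /= /code_word CodeSeq.codeK.
Qed.

Lemma nevalE w : neval (map nl u) (map (@code_letter _ _) w) = map nl (fval (ev w)).
Proof.
rewrite /neval -map_comp (eq_map nwordE) nreduce_flatten; congr map; congr (fval _).
apply: eq_bigr => -[[]|h] _ //=; first by rewrite felt_finv.
exact: felt_fval.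
Qed.

Lemma ncompatE (a b : letter (subgroup H)) :
  ncompat (code_letter a) (code_letter b) = compat a b.
Proof. by case: a b => [[]|?] [[]|?]. Qed.

Lemma ncycleE a w : ncycle (map (@code_letter _ _) (a :: w)) = cycle (@compat _) (a :: w).
Proof.
rewrite /ncycle /= cats1 -map_rcons.
move: (rcons w a) => t; elim: t a => //= b t IH c; rewrite ncompatE; case: compat => //=.
by elim: (t).
Qed.

Lemma nvalidE d w : nvalid (map nl u) d (map (@code_letter _ _) w) =
  [&& good w, count (@is_var _) w == d & ev w == 1%g].
Proof.
rewrite /nvalid nevalE.
have -> : ndegree (map (@code_letter _ _) w) = count (@is_var _) w.
  by rewrite /ndegree; elim: w => //= -[[]|h] w ->.
have -> : nnontriv (map (@code_letter _ _) w) = all (@nontriv _) w.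
  rewrite /nnontriv; elim: w => //= a w ->; congr (_ && _).
  case: a => [[]|h] //=; congr (~~ _).
  rewrite -(inj_eq val_inj) -(inj_eq val_inj) /= /code_word.
  by case: (fval _) => //= l t; rewrite eqSS eqSS muln_eq0 expn_eq0.
have -> : nilp (map nl (fval (ev w))) = (ev w == 1%g).
  by rewrite -(inj_eq val_inj) /=; case: (fval _).
case: w => [|a w]; first by [].
have -> : good (a :: w) = [&& all (@nontriv _) (a :: w), cycle (@compat _) (a :: w) & is_var a].
  by apply/goodP/and3P => -[ns cs hs]; split=> //; case: (a) hs.
rewrite ncycleE; have -> : head 0 (map (@code_letter _ _) (a :: w)) <= 1 = is_var a.
  by case: a => [[]|h].
move: (cycle _ _) (all _ _) (is_var a) (count _ _ == d) (_ == 1%g) => b1 b2 b3 b4 b5 /=.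
by case: b1 b2 b3 b4 b5 => [] [] [] [] [].
Qed.
End Numbering.

(** * The search *)

(** An entry j adds j + 1 binary digits to the code, which is at most e. *)
Lemma code_lt e s : all (fun j => j < e) s -> CodeSeq.code s < 2 ^ (size s * e).
Proof.
elim: s => //= j s IH /andP[je /IH {}IH].
apply: (@leq_trans (2 ^ j * 2 ^ (size s * e).+1)).
  by rewrite ltn_pmul2l ?expn_gt0 // expnS mul2n -(leq_double _.+1) in IH *; lia.
by rewrite -expnD leq_exp2l //; lia.
Qed.

Lemma size_code s : size s <= CodeSeq.code s.
Proof.
elim: s => //= j s IH; apply: leq_ltn_trans IH (leq_trans _ (leq_pmull _ _)).
  by lia.
by rewrite expn_gt0.
Qed.

Section Search.
Variable n : nat.
Local Notation F := (freegroup 'I_n).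

(* [fill_bound] with z for both length bounds and at most 2d factors. *)
Definition part_bound z d :=
  2 ^ (((d.*2.+1 * n.*2.+1 ^ z * n.*2.+1) * n.*2.+1 ^ z *
        (d.*2.+1 * n.*2.+1 ^ z * n.*2.+1))) * 2 ^ (n.*2.+1 ^ z.*2.+1).
(** A candidate has at most 2d entries. A coefficient lists at most [part_bound z d] generator
    numbers below 2z, and by [code_lt] its code is below the inner power; the shift by 2 makes room
    for x and x^-1. *)
Definition search_bound z d := 2 ^ (d.*2 * (2 ^ (part_bound z d * z.*2)).+2).

Lemma computable_search_bound : computable (fun c : unit * nat * nat => search_bound c.1.2 c.2).
Proof. by rewrite /search_bound /part_bound; cmp_auto. Qed.
#[local] Hint Resolve computable_search_bound : computabledb.

(** One bound for the number of generators, their lengths and the length of the target; the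
    successor makes it positive, as [fill_short] requires of M. *)
Definition input_size (gens : seq (seq nat)) (u : seq nat) := (en gens + en u).+1.

Lemma computable_input_size :
  computable (fun c : unit * seq (seq nat) * seq nat => input_size c.1.2 c.2).
Proof.
rewrite /input_size; apply: computable_S.
by apply: (computable_app2 computable_add); apply: computable_en; cmp_auto.
Qed.
#[local] Hint Resolve computable_input_size : computabledb.

Variables (S : seq (word 'I_n)) (u : word 'I_n) (d : nat).
Let fS : seq F := map felt S.
Let H : groupClosed F := gen_group fS.
Let g : F := felt u.
Let gens : seq (seq nat) := map (map (@nl n)) S.
Let un : seq nat := map (@nl n) u.
Local Notation lt := (letter (subgroup H)).
Local Notation lev := (letter_eval (val : subgroup H -> F) g).
Local Notation hlet := (@hletter n S).

Let z := input_size gens un.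

Lemma code_wordE s : en (map (@nl n) s) = code_word s.
Proof. by rewrite /en /enc_seq map_id. Qed.

Lemma code_wordsE : en gens = code_words S.
Proof. by rewrite {1}/en /enc_seq -map_comp (eq_map code_wordE). Qed.

Lemma short_generators : {in fS, forall x, flen x <= z}.
Proof.
move=> _ /mapP[s Ss ->]; apply: leq_trans (flen_felt s) _.
apply: leq_trans (leqW (leq_addr _ _)).
have le : size s <= code_word s by rewrite -(size_map (@nl n)); exact: size_code.
have lt := allP (CodeSeq.ltn_code (map (@code_word n) S)) _ (map_f _ Ss).
by rewrite code_wordsE; exact: leq_trans le (ltnW lt).
Qed.

Lemma short_target : flen g <= z.
Proof.
apply: leq_trans (flen_felt u) _.
have le : size u <= code_word u by rewrite -(size_map (@nl n)); exact: size_code.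
by apply: leq_trans le _; rewrite /z /input_size code_wordE leqW // leq_addl.
Qed.

Lemma size_generators : size fS <= z.
Proof.
have le : size fS <= code_words S.
  rewrite size_map -(size_map (@code_word n)); exact: size_code.
by apply: leq_trans le _; rewrite /z /input_size code_wordsE leqW // leq_addr.
Qed.

Definition shape_letter (a : lt) : option F := if a is inl _ then Some (lev a) else None.

Lemma fits_letters (s : seq lt) : all (@nontriv _) s ->
  all2P (fits fS) (map shape_letter s) (map lev s).
Proof.
elim: s => //= a s IH /andP[na /IH ?]; split=> //.
case: a na => [e|h] //= /eqP nh; split; first exact: (valP h).
by move=> h1; apply: nh; exact: val_inj.
Qed.

(** A slot filled by the product of the generators listed in y becomes the entry
    [(CodeSeq.code y).+2]. *)
Lemma candidate B (s : seq lt) ws : all2P (fits_bounded fS B) (map shape_letter s) ws ->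
  exists cand : seq nat, let t := map hlet cand in
  [/\ all (fun a => a < (2 ^ (B * (size fS).*2)).+2) cand, all (@nontriv _) t,
      map (@pattern _) t = map (@pattern _) s & map lev t = ws].
Proof.
elim: s ws => [|a s IH] [|w ws] //= => [_|[fw /IH[cand [ball nt pt evt]]]].
  by exists [::].
case: a fw => [e|h] /= => [->|[w1 [y [sy yall yw]]]].
  exists (nat_of_bool e :: cand); rewrite /= /hletter ball nt pt evt.
  by case: e.
have hE : hlet (CodeSeq.code y).+2 = inr (@Subgroup _ H (gprod fS y) (gprod_gen fS _)).
  by rewrite /hletter /= subn2 /=; congr inr; apply: val_inj; rewrite /= CodeSeq.codeK.
exists ((CodeSeq.code y).+2 :: cand); rewrite [map _ (_ :: _)]/= hE /= ball nt pt evt !andbT.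
split=> //; last by rewrite yw.
  rewrite !ltnS (leq_trans (code_lt yall)) // leq_exp2l // leq_mul2r.
  by rewrite sy orbT.
by apply/eqP => /(congr1 val) /=; rewrite yw.
Qed.

Definition solution (w : equation H) := [/\ w \in ideal H g, w <> 1%g & degree w = d].

(** A solution is brought into good form by [cycred_good], for which its degree must be positive.
    Then [fill_short] exchanges its coefficients for bounded ones. The pattern stays the same, and
    with it goodness and degree. *)
Lemma search_complete (w : equation H) : 1 <= d -> solution w ->
  exists2 k, k < search_bound z d & nvalid un d (nletters gens k).
Proof.
move=> d1 [/eqP w0 _ wd].
have [|s [gs cs evs]] := cycred_good (pvalP w) (leqnn (size w)) w0.
  by rewrite -/(cyclic_reduction w) -/(degree w) wd.
rewrite -/(cyclic_reduction w) -/(degree w) wd in cs.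
have /andP[ns gp] := gs.
have size_s : size s <= d.*2 by rewrite -cs good_size.
have [||ws ok evw] := fill_short short_generators (M := z) (ltn0Sn _) _ (fits_letters ns).
- move=> b /mapP[[e|h] _ //= [->]].
  by case: e; rewrite ?flenV; exact: short_target.
- by rewrite /wprod big_map.
have [cand [ball nt pt evt]] := candidate ok.
have sizec : size cand = size s.
  by rewrite -(size_map hlet) -(size_map (@pattern _)) pt size_map.
exists (CodeSeq.code cand); last first.
  rewrite /nletters CodeSeq.codeK (eq_map (nletterE S)) map_comp nvalidE.
  rewrite /good nt pt gp /=; apply/andP; split.
    rewrite -cs; apply/eqP; transitivity (count isSome (map (@pattern _) (map hlet cand))).
      by rewrite count_map; apply: eq_count => -[].
    by rewrite pt count_map; apply: eq_count => -[].
  by move: evw; rewrite -evt /wprod big_map => ->.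
apply: leq_trans (code_lt ball) _; rewrite /search_bound leq_exp2l //.
rewrite sizec leq_mul // !ltnS leq_exp2l // leq_mul ?leq_double ?size_generators //.
rewrite /fill_bound /part_bound card_ord size_map leq_mul // leq_exp2l //.
  by rewrite !leq_mul.
by rewrite /gen_bound card_ord.
Qed.

Lemma search_sound k : nvalid un d (nletters gens k) ->
  exists w : equation H, solution w /\ en (nletters gens k) = code_equation w.
Proof.
rewrite /nletters (eq_map (nletterE S)) map_comp nvalidE; set s := map hlet _.
move=> /and3P[gs /eqP cs ev1].
exists (FreeProd (good_reduced gs)); split; last by rewrite /en /enc_seq map_id.
split; first exact: ev1.
  by move=> /(congr1 val) /= s0; move: gs; rewrite s0.
by rewrite /degree /cyclic_reduction /= good_cycred.
Qed.
End Search.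
#[local] Hint Resolve computable_search_bound computable_input_size : computabledb.

Theorem theorem2 (n : nat) :
  exists P : recfun,
  forall (S : seq (word 'I_n)) (u : word 'I_n) (d : nat), 1 <= d ->
  let H : groupClosed (freegroup 'I_n) := gen_group [seq felt s | s <- S] in
  let g : freegroup 'I_n := felt u in
  exists2 r : nat, computes P [:: code_words S; code_word u; d] r &
    (r = 0 /\
     ~ exists w : equation H, [/\ w \in ideal H g, w <> 1%g & degree w = d]) \/
    (exists w : equation H,
     [/\ w \in ideal H g, w <> 1%g & degree w = d] /\
     r = (code_equation w).+1).
Proof.
(* The components of c are, from the outermost, the candidate k, the generators, the target and d.
   This is the order of the arguments of P, with the variable of [Mu] in front. *)
pose found (c : unit * nat * seq nat * seq (seq nat) * nat) :=
  nvalid c.1.1.2 c.1.1.1.2 (nletters c.1.2 c.2).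
pose stop c := found c || (search_bound n (input_size c.1.2 c.1.1.2) c.1.1.1.2 <= c.2).
have cfound : computable found by rewrite /found; cmp_auto.
(* [Mu] looks for a zero, and the code of false is 0; the bound built into [stop] makes the search
   terminate. *)
have [C HC] : computable (fun c => ~~ stop c).
  apply: (computable_app1 computable_negb); apply: (computable_app2 computable_orb cfound).
  by cmp_auto.
have [O HO] : computable (fun c => if found c then (en (nletters c.1.2 c.2)).+1 else 0).
  apply: computable_if => //; last exact: computable_const.
  apply: computable_S; apply: computable_en.
  by cmp_auto.
exists (Comp O [:: Mu C; Proj 0; Proj 1; Proj 2]) => S u d d1 H g.
pose gens := map (map (@nl n)) S; pose un := map (@nl n) u.
pose c (k : nat) := (tt, d, un, gens, k).
have lstE k : lst (c k) = [:: k; code_words S; code_word u; d].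
  by rewrite /= [en un]code_wordE [en gens]code_wordsE.
have ex_stop : exists k, stop (c k).
  by exists (search_bound n (input_size gens un) d); rewrite /stop leqnn orbT.
case: (ex_minnP ex_stop) => k stopk mink.
(* Before the stop C returns 1, the successor of 0. *)
have computes_mu : computes (Mu C) [:: code_words S; code_word u; d] k.
  apply: (@computes_Mu _ _ _ (fun=> 0)) => [i ik|].
    have := HC (c i); rewrite lstE; suff -> : stop (c i) = false by [].
    by apply: contraTF ik => /mink; rewrite -leqNgt.
  by have := HC (c k); rewrite lstE stopk.
exists (if found (c k) then (en (nletters gens k)).+1 else 0).
  by have := HO (c k); rewrite lstE; apply: computes_Comp; repeat constructor.
case: ifP => fk.
  right; have [w [sw wE]] := search_sound fk.
  by exists w; rewrite -wE.
left; split=> // -[w sw]; have [j jlt fj] := search_complete d1 sw.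
(* The search has stopped without success, hence at or beyond the bound, yet a valid j below the
   bound would have stopped it earlier. *)
have kj : k <= j by apply: mink; rewrite /stop /found fj.
by move: stopk; rewrite /stop fk /= leqNgt (leq_ltn_trans kj jlt).
Qed.
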